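(* For every integer $k \geq 3$ there exists a constant $C_k$ such that for all integers $r \geq 2$, $$s_r(K_{k}) \leq C_k (r\log r)^2.$$
   Context: All graphs are finite and simple; $K_k$ is the complete graph on $k$ vertices. A graph $G$ is $r$-Ramsey for a graph $H$ if every coloring of the edges of $G$ with $r$ colors contains a monochromatic copy of $H$. A graph $G$ is $r$-Ramsey-minimal for $H$ if it is $r$-Ramsey for $H$ but no proper subgraph of $G$ is $r$-Ramsey for $H$. Let $\mathcal{M}_r(H)$ be the set of all $r$-Ramsey-minimal graphs for $H$. Define $s_r(H) := \min\{\delta(G) : G \in \mathcal{M}_r(H)\}$, where $\delta(G)$ is the minimum degree of $G$. The base of $\log$ is immaterial (it only affects $C_k$). *)

(* Defs.v *)
From mathcomp Require Import all_boot.
Set Implicit Arguments.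
Unset Strict Implicit.
Unset Printing Implicit Defensive.

(* A finite simple graph whose vertices form a subset of an ambient finite type
   [T].  Carrying the vertex set separately from [T] lets all the subgraphs of a
   graph, including those with fewer vertices, live in the same type. *)
Record graph (T : finType) := Graph {
  vertices : {set T};
  edges : {set {set T}};
  edges_wf : edges \subset [set e : {set T} | (e \subset vertices) && (#|e| == 2)]
}.

Section Graphs.
Variable T : finType.
Implicit Types G : graph T.

Lemma graph_eq G1 G2 :
  vertices G1 = vertices G2 -> edges G1 = edges G2 -> G1 = G2.
Proof.
case: G1 G2 => [V1 E1 w1] [V2 E2 w2] /= eV eE; subst V2 E2.
by rewrite (bool_irrelevance w1 w2).
Qed.

Definition degree G (v : T) : nat := #|[set e in edges G | v \in e]|.

(* Every degree is smaller than the number of vertices, so the default value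
   [#|vertices G|] is only attained by the graph without vertices. *)
Definition min_degree G : nat :=
  \big[minn/#|vertices G|]_(v in vertices G) degree G v.

Definition subgraph G' G : Prop :=
  vertices G' \subset vertices G /\ edges G' \subset edges G.

Definition proper_subgraph G' G : Prop := subgraph G' G /\ G' <> G.

End Graphs.

Lemma complete_graph_wf (k : nat) :
  [set e : {set 'I_k} | #|e| == 2] \subset
  [set e : {set 'I_k} | (e \subset [set: 'I_k]) && (#|e| == 2)].
Proof. by apply/subsetP => e; rewrite !inE subsetT. Qed.

Definition complete_graph (k : nat) : graph 'I_k :=
  Graph (complete_graph_wf k).

(* [f] embeds [H] in [G], as a not necessarily induced subgraph; only the
   values of [f] on the vertices of [H] matter. *)
Definition is_copy (U T : finType) (H : graph U) (G : graph T) (f : U -> T)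
    : Prop :=
  [/\ {in vertices H &, injective f},
      {in vertices H, forall u, f u \in vertices G} &
      {in edges H, forall e : {set U}, f @: e \in edges G}].

(* A coloring is given on all sets of vertices, but only the colors of the
   edges of [G] matter, as a copy of [H] in [G] has its edges in [G]. *)
Definition ramsey (U T : finType) (r : nat) (H : graph U) (G : graph T)
    : Prop :=
  forall c : {set T} -> 'I_r,
  exists (f : U -> T) (i : 'I_r),
    is_copy H G f /\ {in edges H, forall e : {set U}, c (f @: e) = i}.

Definition ramsey_minimal (U T : finType) (r : nat) (H : graph U) (G : graph T)
    : Prop :=
  ramsey r H G /\
  forall G' : graph T, proper_subgraph G' G -> ~ ramsey r H G'.

Definition is_minimum (A : nat -> Prop) (m : nat) : Prop :=
  A m /\ forall n, A n -> m <= n.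

(* The parameter s_r(H), as the relation "s_r(H) exists and equals s". *)
Definition is_s (U : finType) (r : nat) (H : graph U) (s : nat) : Prop :=
  is_minimum
    (fun d => exists (T : finType) (G : graph T),
       ramsey_minimal r H G /\ min_degree G = d) s.

(* Main.v *)
Require Import Defs.
From HB Require Import structures.
From mathcomp Require Import all_boot zify.
Set Implicit Arguments.
Unset Strict Implicit.
Unset Printing Implicit Defensive.

(* Let m = k - 1.  Call a family of edge-disjoint K_k-free graphs G_1, ..., G_r
   on n vertices a pattern if every colouring of the vertices with r colours
   has, for some i, a copy of K_m in G_i all of whose vertices have colour i.

   A pattern gives s_r(K_k) <= n.  By the partite construction of Nesetril and
   Rodl, applied to one colour at a time, there is an r-edge-coloured graph F
   without monochromatic K_k such that in every other colouring chi of F some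
   copy of the pattern has its chi-colours obtained from the pattern colours by
   a map sigma; adding small gadgets to the pattern forces sigma to be injective
   unless chi has a monochromatic K_k.  Joining, for each placement of the
   pattern in F, a new vertex to the n vertices of the placement gives a
   Ramsey graph.  As F is not Ramsey, each minimal Ramsey subgraph contains a
   new vertex, which has degree at most n.

   A pattern with n = O((r log r)^2) is obtained from a sequence of random
   blocks: random vertex sets of about r vertices, each with a random partition
   into m parts and assigned to one of the colours.  In a block of colour i,
   join in G_i the vertices in different parts, except for the pairs that
   already lie in an earlier block or that would close a triangle with two
   earlier blocks of colour i.  Then all the edges of a clique in G_i come from
   one block, so G_i has no K_(m+1).  Let X be a set of t = n / r vertices.  If
   few pairs in X are excluded, the next block of colour i gives a K_m in X with
   probability at least 1/2, whatever the past, and there are enough blocks of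
   each colour to afford a union bound over X.  The number of pairs excluded by
   triangles is at most the sum of z_a z_b over the pairs of meeting blocks a, b,
   where z_a is the number of vertices of X in a.  Since z_a is bounded and the
   z_a have a bounded sum, this is maximal when z is concentrated on
   polylogarithmically many blocks, and a first moment bound shows that no such
   set of blocks has many meeting pairs. *)

(** * The Hales-Jewett theorem *)

Section HalesJewett.
Variable (A : finType).

(** A combinatorial line is a word over [option A], where [None] marks the moving coordinates. *)
Definition line_at (I : finType) (l : {ffun I -> option A}) (x : A) :
  {ffun I -> A} := [ffun t => odflt x (l t)].

Definition active (I : finType) (l : {ffun I -> option A}) :=
  [exists t, l t == None].

(** Asking for constancy only on the letters of [s] allows letters to be added one at a time. *)
Definition mono_line (I K : finType) (C : {ffun I -> A} -> K) (s : seq A)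
    (l : {ffun I -> option A}) :=
  active l /\ exists c, {in s, forall x, C (line_at l x) = c}.

Definition sumf (I I' : finType) (B : Type) (u : {ffun I -> B}) (v : {ffun I' -> B}) :
  {ffun I + I' -> B} :=
  [ffun t => match t with inl i => u i | inr i => v i end].

Definition const_line (I : finType) (u : {ffun I -> A}) : {ffun I -> option A} :=
  [ffun t => Some (u t)].

Lemma line_at_sumf (I I' : finType) (l : {ffun I -> option A})
    (l' : {ffun I' -> option A}) x :
  line_at (sumf l l') x = sumf (line_at l x) (line_at l' x).
Proof. by apply/ffunP => -[t|t]; rewrite !ffunE. Qed.

Lemma line_at_const (I : finType) (u : {ffun I -> A}) x :
  line_at (const_line u) x = u.
Proof. by apply/ffunP => t; rewrite !ffunE. Qed.

Lemma active_sumfl (I I' : finType) (l : {ffun I -> option A})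
    (l' : {ffun I' -> option A}) : active l -> active (sumf l l').
Proof.
by move=> /existsP[t /eqP lt]; apply/existsP; exists (inl t); rewrite ffunE lt.
Qed.

Lemma active_sumfr (I I' : finType) (l : {ffun I -> option A})
    (l' : {ffun I' -> option A}) : active l' -> active (sumf l l').
Proof.
by move=> /existsP[t /eqP lt]; apply/existsP; exists (inr t); rewrite ffunE lt.
Qed.

(* Colour focusing: [q] lines with pairwise distinct colours on the letters of
   [s], all passing through the same point at the letter [a]. *)
Lemma focused_lines (a : A) (s : seq A) :
  (forall K : finType, exists I : finType, forall C : {ffun I -> A} -> K,
     exists l, mono_line C s l) ->
  forall (K : finType) (q : nat), exists I : finType,
  forall C : {ffun I -> A} -> K,
    (exists l, mono_line C (a :: s) l) \/
    exists (f : {ffun I -> A}) (L : seq ({ffun I -> option A} * K)),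
      [/\ size L = q, uniq (map snd L) &
        {in L, forall p, [/\ active p.1, line_at p.1 a = f &
           {in s, forall x, C (line_at p.1 x) = p.2}]}].
Proof.
move=> HJs K; elim=> [|q [I IHq]].
  by exists unit => C; right; exists [ffun => a], [::].
(* The colours used on [I'] are entire colourings of the words on [I]: along [l'] the induced
   colouring [C'] does not depend on the letter taken from [s]. *)
have [I' HI'] := HJs {ffun {ffun I -> A} -> K}.
exists (I + I')%type => C.
have [l' [actl' [C' HC']]] :=
  HI' (fun v => [ffun u => C (sumf u v)]).
have CE x u : x \in s -> C (sumf u (line_at l' x)) = C' u.
  by move=> xs; rewrite -(HC' _ xs) ffunE.
(* For empty [s] only the letter [a] matters, and any active line will do. *)
move: HI' => _; case: s HJs IHq HC' CE => [|x0 s'] HJs IHq HC' CE.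
  left; exists [ffun => None]; split; last first.
    by exists (C [ffun => a]) => x; rewrite inE => /eqP ->; congr C; apply/ffunP => t; rewrite !ffunE.
  have /existsP[t _] := actl'.
  by apply/existsP; exists (inr t); rewrite ffunE.
set s := x0 :: s' in HJs IHq HC' CE *.
have x0s : x0 \in s by rewrite mem_head.
case: (IHq C') => [[l [actl [c Hc]]]|[f [L [sL uL HL]]]].
  left; exists (sumf l (const_line (line_at l' x0))); split.
    exact: active_sumfl.
  exists c => x xs; rewrite line_at_sumf line_at_const CE //; exact: Hc.
pose up (p : {ffun I -> option A} * K) := (sumf p.1 l', p.2).
pose f2 := sumf f (line_at l' a).
have HL2 : {in map up L, forall p, [/\ active p.1, line_at p.1 a = f2 &
           {in s, forall x, C (line_at p.1 x) = p.2}]}.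
  move=> _ /mapP[p pL ->] /=; have [ap pa pc] := HL _ pL; split.
  - exact: active_sumfl.
  - by rewrite line_at_sumf pa.
  - by move=> x xs; rewrite line_at_sumf CE // pc.
(* If the focus has the colour of one of the lines, that line is monochromatic on [a] too; otherwise
   moving along [l'] above the focus gives a line of a new colour. *)
have [/mapP[p pL pe]|nC'] := boolP (C' f \in map snd L).
  have [ap pa pc] := HL _ pL.
  left; exists (sumf p.1 (const_line (line_at l' x0))); split.
    exact: active_sumfl.
  exists p.2 => x; rewrite line_at_sumf line_at_const CE // inE.
  by case/predU1P => [->|/pc //]; rewrite pa.
right; exists f2, ((sumf (const_line f) l', C' f) :: map up L); split.
- by rewrite /= size_map sL.
- by rewrite /= -map_comp (eq_map (g := snd)) // nC'.
move=> p; rewrite inE => /predU1P[->|]; last exact: HL2.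
split=> /=.
- exact: active_sumfr.
- by rewrite line_at_sumf line_at_const.
- by move=> x xs; rewrite line_at_sumf line_at_const CE.
Qed.

Lemma hales_jewett_seq (x0 : A) (s : seq A) (K : finType) :
  exists I : finType, forall C : {ffun I -> A} -> K, exists l, mono_line C s l.
Proof.
elim: s K => [|a s IHs] K.
  exists unit => C; exists [ffun => None]; split.
    by apply/existsP; exists tt; rewrite ffunE.
  by exists (C [ffun => x0]).
(* More lines of distinct colours than there are colours cannot exist, which leaves the
   monochromatic line. *)
have [I HI] := focused_lines a IHs K #|K|.+1.
exists I => C; have [//|[f [L [sL uL _]]]] := HI C.
by have := max_card (mem (map snd L)); rewrite (card_uniqP uL) size_map sL ltnn.
Qed.

Lemma hales_jewett (x0 : A) (K : finType) :
  exists I : finType, forall C : {ffun I -> A} -> K,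
    exists (l : {ffun I -> option A}) (c : K),
      active l /\ forall x, C (line_at l x) = c.
Proof.
have [I HI] := hales_jewett_seq x0 (enum A) K.
exists I => C; have [l [al [c Hc]]] := HI C.
by exists l, c; split=> // x; rewrite Hc ?mem_enum.
Qed.
End HalesJewett.

(** * Edge colourings of partite systems *)

Definition clique_map (T : finType) (e : rel T) (k : nat) (g : 'I_k -> T) :=
  forall a b : 'I_k, a != b -> e (g a) (g b).

(* [E i] is the graph formed by the edges of colour [i]. *)
Definition kfree_coloring (T K : finType) (k : nat) (E : K -> rel T) : Prop :=
  [/\ forall i, symmetric (E i), forall i, irreflexive (E i),
      forall i i' x y, E i x y -> E i' x y -> i = i' &
      forall i (g : 'I_k -> T), ~ clique_map (E i) g].

Section PartiteStep.
Variables (T K P : finType) (k : nat) (E : K -> rel T) (part : T -> P).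
Hypothesis k_ge3 : 2 < k.
Hypothesis Efree : kfree_coloring k E.
Hypothesis Epart : forall i x y, E i x y -> part x != part y.
Variables (j : K) (p q : P).
Hypothesis pq : p != q.

Let A : finType := {e : T * T | [&& part e.1 == p, part e.2 == q & E j e.1 e.2]}.
Variable I : finType.

Let T' : finType := ({ffun I -> T} + {ffun I -> option A} * T)%type.

(** The copy along [l]. A vertex of part [p] or [q] becomes a word showing the vertex itself where
    [l] moves and the matching end of the edge [l t] elsewhere; any other vertex is duplicated for
    each line. *)
Definition step_emb (l : {ffun I -> option A}) (x : T) : T' :=
  if (part x == p) || (part x == q) then
    inl [ffun t => if l t is Some e then
                     (if part x == p then (val e).1 else (val e).2) else x]
  else inr (l, x).

(** The coordinates of a word embedded along a line all lie in one part, so any of them may be read;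
    [p] is the default for empty [I]. *)
Definition step_part (a : T') : P :=
  match a with
  | inl f => if [pick t : I] is Some t then part (f t) else p
  | inr (_, x) => part x
  end.

Definition step_edges (i : K) : rel T' := fun a b =>
  [exists l, exists x, exists y,
    [&& active l, a == step_emb l x, b == step_emb l y & E i x y]].

Lemma step_edgesP i a b :
  reflect (exists l x y, [/\ active l, a = step_emb l x, b = step_emb l y & E i x y])
          (step_edges i a b).
Proof.
apply: (iffP existsP) => [[l /existsP[x /existsP[y /and4P[al /eqP-> /eqP-> e]]]]|].
  by exists l, x, y.
move=> [l [x [y [al -> -> e]]]]; exists l; apply/existsP; exists x.
by apply/existsP; exists y; rewrite al !eqxx.
Qed.

Lemma step_part_emb l x : active l -> step_part (step_emb l x) = part x.
Proof.
move=> /existsP[t0 _]; rewrite /step_emb /step_part.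
case: ifP => // /orP hx; case: pickP => [t _|/(_ t0)//]; rewrite ffunE.
case: (l t) => // -[e /= /and3P[/eqP e1 /eqP e2 _]].
case: eqP hx => [->//|_ [//|/eqP->]]; exact: e2.
Qed.

Lemma step_emb_inl l x : (part x == p) || (part x == q) ->
  step_emb l x = inl [ffun t => if l t is Some e then
                     (if part x == p then (val e).1 else (val e).2) else x].
Proof. by rewrite /step_emb => ->. Qed.

Lemma step_emb_inr l x : (part x == p) || (part x == q) = false ->
  step_emb l x = inr (l, x).
Proof. by rewrite /step_emb => ->. Qed.

(** Outside [p] and [q] a vertex records its line, so distinct copies meet only in these two
    parts. *)
Lemma step_emb_other l l' x y : active l -> active l' ->
  (part x == p) || (part x == q) = false ->
  step_emb l x = step_emb l' y -> l = l' /\ x = y.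
Proof.
move=> al al' hx e.
have pxy : part x = part y by rewrite -(step_part_emb x al) e step_part_emb.
by move: e; rewrite !step_emb_inr -?pxy // => -[].
Qed.

Lemma step_emb_inj l : active l -> injective (step_emb l).
Proof.
move=> al x y e.
have pxy : part x = part y by rewrite -(step_part_emb x al) e step_part_emb.
have [hx|hx] := boolP ((part x == p) || (part x == q)); last first.
  by have [] := step_emb_other al al (negbTE hx) e.
have /existsP[t /eqP lt] := al.
move: e; rewrite !step_emb_inl -?pxy // => -[] /ffunP/(_ t).
by rewrite !ffunE lt.
Qed.

Lemma step_emb_coord l l' x x' t : active l -> active l' ->
  step_emb l x = step_emb l' x' -> (part x == p) || (part x == q) ->
  (if l t is Some e then (if part x == p then (val e).1 else (val e).2) else x) =
  (if l' t is Some e then (if part x == p then (val e).1 else (val e).2) else x').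
Proof.
move=> al al' e hx.
have pxy : part x = part x' by rewrite -(step_part_emb x al) e step_part_emb.
by move: e; rewrite !step_emb_inl -?pxy // => -[] /ffunP/(_ t); rewrite !ffunE.
Qed.

(* The copies are induced: where the lines [l] and [l'] are not active at the
   same place, the pair is an edge of colour [j] in both copies. *)
Lemma step_emb_edge i l l' x y x' y' : active l -> active l' ->
  step_emb l x = step_emb l' x' -> step_emb l y = step_emb l' y' ->
  E i x' y' -> E i x y.
Proof.
have [Esym Eirr Edisj _] := Efree.
wlog: x y x' y' / part x == p.
  move=> wl al al' ex ey e.
  have [hx|hx] := boolP ((part x == p) || (part x == q)); last first.
    have [ll xx] := step_emb_other al al' (negbTE hx) ex.
    by move: ey e; rewrite -ll -xx => /(step_emb_inj al) <-.
  case: (boolP (part x == p)) hx => [px _|npx /= qx]; first exact: (wl x y x' y').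
  have [hy|hy] := boolP ((part y == p) || (part y == q)); last first.
    have [ll xx] := step_emb_other al al' (negbTE hy) ey.
    by move: ex e; rewrite -ll -xx => /(step_emb_inj al) <-.
  case: (boolP (part y == p)) hy => [py _|npy /= qy].
    by rewrite Esym; apply: (wl y x y' x') => //; rewrite Esym.
  have := Epart e.
  by rewrite -(step_part_emb x' al') -ex -(step_part_emb y' al') -ey !step_part_emb //
             (eqP qx) (eqP qy) eqxx.
move=> px al al' ex ey e.
have [hy|hy] := boolP ((part y == p) || (part y == q)); last first.
  have [ll xx] := step_emb_other al al' (negbTE hy) ey.
  by move: ex e; rewrite -ll -xx => /(step_emb_inj al) <-.
have := Epart e.
rewrite -(step_part_emb x' al') -ex -(step_part_emb y' al') -ey !step_part_emb //.
rewrite (eqP px) eq_sym => /negbTE npy; move: (hy); rewrite npy /= => qy.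
have hx : (part x == p) || (part x == q) by rewrite px.
have cx t := step_emb_coord t al al' ex hx.
have cy t := step_emb_coord t al al' ey hy.
have /existsP[t /eqP lt] := al.
have /existsP[t' /eqP lt'] := al'.
(* Where [l'] moves, the words show [(x', y')]; if [l] is fixed there, this is an edge of colour
   [j], so [i = j]. Likewise a place where [l] moves shows [(x, y)]. *)
have := cx t'; have := cy t'; rewrite lt' px npy.
case: (l t') => [[e1 /= /and3P[_ _ he1]]|]; last by move=> -> ->.
move=> ey' ex'; have ij : i = j by apply: Edisj e _; rewrite -ex' -ey'.
have := cx t; have := cy t; rewrite lt px npy.
case: (l' t) => [[e2 /= /and3P[_ _ he2]]|]; last by move=> -> ->.
by move=> -> ->; rewrite ij.
Qed.

Lemma step_edges_part i a b : step_edges i a b -> step_part a != step_part b.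
Proof.
move=> /step_edgesP[l [x [y [al -> -> e]]]]; rewrite !step_part_emb //.
exact: Epart e.
Qed.

(** A clique meets each part at most once, so for [k > 2] it has a vertex outside [p] and [q]. This
    vertex determines the line, its neighbours lie in the same copy, and as copies are induced the
    clique comes from [E]. *)
Lemma step_edges_free : kfree_coloring k step_edges.
Proof.
have [Esym Eirr Edisj Efr] := Efree.
split.
- move=> i a b; apply/step_edgesP/step_edgesP => -[l [x [y [al -> -> e]]]];
  by exists l, y, x; rewrite Esym.
- move=> i a; case e: (step_edges i a a) => //.
  by have := step_edges_part e; rewrite eqxx.
- move=> i i' a b /step_edgesP[l [x [y [al ex ey e]]]].
  move=> /step_edgesP[l' [x' [y' [al' ex' ey' e']]]].
  apply: Edisj e _; apply: (@step_emb_edge i' l l' x y x' y') => //; congruence.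
move=> i g cl.
have [w wp] : exists w, (step_part (g w) == p) || (step_part (g w) == q) = false.
  have inj : injective (step_part \o g).
    move=> a b /= eab; apply/eqP; apply: contraT => nab.
    by move/step_edges_part: (cl a b nab); rewrite eab eqxx.
  have : ~~ ([set: 'I_k] \subset [set w | (step_part (g w) == p) || (step_part (g w) == q)]).
    apply: contraL k_ge3 => /subset_leq_card; rewrite cardsT card_ord -leqNgt => /leq_trans; apply.
    rewrite -(card_imset _ inj).
    apply: (@leq_trans #|[set p; q]|); last by rewrite cards2 pq.
    by apply: subset_leq_card; apply/subsetP => b /imsetP[a]; rewrite !inE => ha ->.
  by case/subsetPn => w _; rewrite inE => /negbTE; exists w.
have [w' ww'] : exists w', w' != w.
  have : 1 < #|'I_k| by rewrite card_ord ltnW.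
  by case/card_gt1P => a [b [_ _]]; case: (eqVneq a w) => [->|]; [rewrite eq_sym; exists b | exists a].
have [l [xw [_ [al exw _ _]]]] := step_edgesP _ _ _ (cl w w' (ltac:(by rewrite eq_sym))).
have pxw : (part xw == p) || (part xw == q) = false by rewrite -(step_part_emb xw al) -exw.
have H b : exists x, g b = step_emb l x.
  have [->|nb] := eqVneq b w; first by exists xw.
  have [l' [x' [y' [al' ex' ey' _]]]] := step_edgesP _ _ _ (cl w b (ltac:(by rewrite eq_sym))).
  exists y'; rewrite ey'; congr (step_emb _ y'); apply/esym.
  by have [] := step_emb_other al al' pxw (etrans (esym exw) ex').
have [f fP] : exists f : 'I_k -> T, forall b, g b = step_emb l (f b).
  have H' b : exists x, g b == step_emb l x by case: (H b) => x ->; exists x.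
  by exists (fun b => xchoose (H' b)) => b; exact/eqP/(xchooseP (H' b)).
apply: (Efr i f) => a b /cl /step_edgesP[l' [x [y [al' ex ey e]]]].
by apply: (step_emb_edge al al') e; rewrite -fP.
Qed.
End PartiteStep.

Definition edge_hom (T T' K : finType) (E : K -> rel T) (E' : K -> rel T')
  (h : T -> T') := forall i x y, E i x y -> E' i (h x) (h y).

(** The letters for Hales-Jewett are the [j]-edges from part [p] to part [q], and a word of edges is
    coloured by [chi] at its two end words. *)
Lemma partite_step (T K P C : finType) (c0 : C) (k : nat) (E : K -> rel T)
    (part : T -> P) (j : K) (p q : P) :
  2 < k -> p != q -> kfree_coloring k E ->
  (forall i x y, E i x y -> part x != part y) ->
  exists (T' : finType) (E' : K -> rel T') (part' : T' -> P),
  [/\ kfree_coloring k E', forall i x y, E' i x y -> part' x != part' y &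
   forall chi : T' -> T' -> C, exists h : T -> T',
     [/\ edge_hom E E' h, forall x, part' (h x) = part x &
      exists c, forall x y, part x = p -> part y = q -> E j x y ->
        chi (h x) (h y) = c]].
Proof.
move=> k3 pq Ef Ep.
pose good (e : T * T) := [&& part e.1 == p, part e.2 == q & E j e.1 e.2].
(* Hales-Jewett needs a letter; without such edges the system itself will do. *)
case: (pickP good) => [e0 he0|none]; last first.
  exists T, E, part; split=> // chi; exists id; split=> //.
  by exists c0 => x y px qy e; have := none (x, y); rewrite /good /= px qy e !eqxx.
have [I HI] := hales_jewett (Sub e0 he0 : {e | good e}) C.
exists ({ffun I -> T} + {ffun I -> option {e | good e}} * T)%type.
exists (@step_edges T K P E part j p q I), (@step_part T K P E part j p q I); split.
- exact: step_edges_free.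
- move=> i x y; exact: step_edges_part.
move=> chi.
have [l [c [al Hc]]] := HI (fun f => chi (inl [ffun t => (val (f t)).1]) (inl [ffun t => (val (f t)).2])).
exists (@step_emb T K P E part j p q I l); split.
- by move=> i x y e; apply/step_edgesP; exists l, x, y.
- by move=> x; apply: step_part_emb.
exists c => x y px qy e.
have he : good (x, y) by rewrite /good /= px qy !eqxx.
rewrite -(Hc (Sub (x, y) he)) !step_emb_inl ?px ?qy ?eqxx ?orbT //.
rewrite [q == p]eq_sym (negbTE pq).
by congr (chi (inl _) (inl _)); apply/ffunP => t; rewrite !ffunE; case: (l t).
Qed.

(** The pairs of [s] are treated in turn. Embeddings preserve parts and edges, so a pair made
    constant stays so in a smaller copy. *)
Lemma partite_construction (T K P C : finType) (c0 : C) (k : nat)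
    (E : K -> rel T) (part : T -> P) (j : K) (s : seq (P * P)) :
  2 < k -> all (fun u => u.1 != u.2) s -> kfree_coloring k E ->
  (forall i x y, E i x y -> part x != part y) ->
  exists (T' : finType) (E' : K -> rel T'), kfree_coloring k E' /\
   forall chi : T' -> T' -> C, exists h : T -> T', edge_hom E E' h /\
     exists c : P * P -> C, forall x y, (part x, part y) \in s -> E j x y ->
        chi (h x) (h y) = c (part x, part y).
Proof.
move=> k3; elim: s T E part => [|[p q] s IH] T E part /=.
  by move=> _ Ef _; exists T, E; split=> // chi; exists id; split=> //; exists (fun=> c0).
move=> /andP[pq sP] Ef Ep.
have [T1 [E1 [part1 [Ef1 Ep1 H1]]]] := partite_step c0 j k3 pq Ef Ep.
have [T2 [E2 [Ef2 H2]]] := IH T1 E1 part1 sP Ef1 Ep1.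
exists T2, E2; split=> // chi; have [h2 [hom2 [c2 Hc2]]] := H2 chi.
have [h1 [hom1 hp1 [c1 Hc1]]] := H1 (fun x y => chi (h2 x) (h2 y)).
exists (h2 \o h1); split; first by move=> i x y /hom1/hom2.
exists (fun u => if u == (p, q) then c1 else c2 u) => x y.
rewrite inE; case: eqP => [[px qy] _|_ /= sxy] e /=; first exact: Hc1.
rewrite -(hp1 x) -(hp1 y); apply: Hc2; [by rewrite !hp1|exact: hom1].
Qed.

(** * Ramsey's theorem for pairs *)

Lemma pigeonhole_class (P C : finType) (c0 : C) (f : P -> C) (S : {set P}) (t : nat) :
  #|C| * t <= #|S| -> exists c, t <= #|[set x in S | f x == c]|.
Proof.
move=> h; apply/existsP; apply: contraLR h => /existsPn none.
case: t none => [/(_ c0)//|t none].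
have Cpos : 0 < #|C| by apply/card_gt0P; exists c0.
rewrite -ltnNge -sum1_card (partition_big f xpredT) //=.
apply: (@leq_ltn_trans (\sum_(c : C) t)).
  apply: leq_sum => c _; rewrite sum1dep_card -ltnS ltnNge.
  have := none c; by congr (~~ (_ < _)); apply: eq_card => x; rewrite !inE.
by rewrite sum_nat_const mulnS -[X in X < _]add0n ltn_add2r.
Qed.

(** Pick [x], keep a large colour class of [c x] among the rest and repeat: the colour of a pair is
    decided by its earlier element. *)
Lemma ramsey_sequence (C : finType) (c0 : C) (n : nat) : exists N, forall (P : finType)
    (S : {set P}) (c : P -> P -> C), N <= #|S| ->
  exists (s : seq P) (d : P -> C), [/\ size s = n, uniq s, {subset s <= S} &
    pairwise (fun x y => c x y == d x) s].
Proof.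
elim: n => [|n [N IH]].
  by exists 0 => P S c _; exists [::], (fun=> c0).
exists (#|C| * N).+1 => P S c hS.
have /card_gt0P[x xS] : 0 < #|S| by apply: leq_trans hS.
have hS' : #|C| * N <= #|S :\ x| by rewrite -ltnS (leq_trans hS) // (cardsD1 x S) xS.
have [e he] := pigeonhole_class c0 (c x) hS'.
have [s [d [ss us sS ps]]] := IH P _ c he.
have xs : x \notin s by apply/negP => /sS; rewrite !inE eqxx.
exists (x :: s), (fun y => if y == x then e else d y); split.
- by rewrite /= ss.
- by rewrite /= xs us.
- move=> y; rewrite inE => /predU1P[->//|/sS]; by rewrite !inE => /andP[/andP[]].
rewrite /= eqxx; apply/andP; split.
  by apply/allP => y /sS; rewrite !inE => /andP[].
rewrite (_ : pairwise _ s = pairwise (fun x y => c x y == d x) s) //.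
have sub : all (predC1 x) s by apply/allP => y ys /=; apply: contraNneq xs => <-.
apply: (eq_in_pairwise (P := predC1 x)) sub => y z; by rewrite !inE => /negbTE->.
Qed.

Lemma ramsey_pairs (C : finType) (c0 : C) (n : nat) : exists N, forall (P : finType)
    (c : P -> P -> C), (forall x y, c x y = c y x) -> N <= #|P| ->
  exists (S : {set P}) (d : C), n <= #|S| /\
    {in S &, forall x y, x != y -> c x y = d}.
Proof.
have [N HN] := ramsey_sequence c0 (#|C| * n).
exists N => P c csym; rewrite -cardsT => /(HN P _ c)[s [d [ss us _ ps]]].
have : #|C| * n <= #|[set x in s]| by rewrite cardsE (card_uniqP us) ss.
case/(pigeonhole_class c0 d) => e he; exists [set x in [set x in s] | d x == e], e; split=> //.
move=> x y; rewrite !inE => /andP[xs /eqP dx] /andP[ys /eqP dy].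
wlog: x y xs ys dx dy / index x s <= index y s => [wl nxy|].
  case/orP: (leq_total (index x s) (index y s)) => ?; first exact: wl.
  by rewrite csym; apply: wl => //; rewrite eq_sym.
rewrite leq_eqVlt => /orP[/eqP ixy|ixy]; first by rewrite -(nth_index x ys) -ixy nth_index ?eqxx.
move=> _; move/(pairwiseP x): ps => /(_ (index x s) (index y s)).
by rewrite !inE !index_mem !nth_index // dx => /(_ xs ys ixy)/eqP.
Qed.

(** Take a copy of the system for each injection [f] of [T] into ['I_N], with [(f, x)] in part
    [f x]. After the partite construction the colour of a [j]-edge depends only on its two parts.
    Ramsey's theorem gives [#|T|] parts on which it is constant, and some [f] maps into them. *)
Lemma edge_ramsey_color (T K C : finType) (c0 : C) (k : nat)
    (E : K -> rel T) (j : K) :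
  2 < k -> kfree_coloring k E ->
  exists (T' : finType) (E' : K -> rel T'), kfree_coloring k E' /\
   forall chi : T' -> T' -> C, (forall x y, chi x y = chi y x) ->
     exists h : T -> T', edge_hom E E' h /\
     exists d : C, forall x y, E j x y -> chi (h x) (h y) = d.
Proof.
move=> k3 Ef; have [Esym Eirr Edisj Efr] := Ef.
have [N HN] := ramsey_pairs c0 #|T|.
pose T0 : finType := ({ffun T -> 'I_N} * T)%type.
pose E0 i : rel T0 := fun u v => [&& u.1 == v.1, injectiveb u.1 & E i u.2 v.2].
pose part (u : T0) : 'I_N := u.1 u.2.
have E0p i u v : E0 i u v -> part u != part v.
  case/and3P => /eqP uv /injectiveP inj e; rewrite /part -uv inj_eq //.
  by apply: contraTneq e => ->; rewrite Eirr.
have E0f : kfree_coloring k E0.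
  split.
  - by move=> i u v; rewrite /E0 eq_sym Esym; case: eqP => // ->.
  - by move=> i u; rewrite /E0 Eirr !andbF.
  - by move=> i i' u v /and3P[_ _ e] /and3P[_ _]; apply: Edisj.
  - move=> i g cl; apply: (Efr i (snd \o g)) => a b /cl; by case/and3P.
(* Only increasing pairs are treated; the symmetry of [chi] covers the others. *)
pose s : seq ('I_N * 'I_N) := [seq u : 'I_N * 'I_N <- enum {: 'I_N * 'I_N} | u.1 < u.2].
have sP : all (fun u => u.1 != u.2) s.
  by apply/allP => u; rewrite mem_filter => /andP[lt _]; rewrite -val_eqE ltn_eqF.
have [T' [E' [Ef' H']]] := partite_construction c0 j k3 sP E0f E0p.
exists T', E'; split=> // chi chisym; have [h [hom [c Hc]]] := H' chi.
pose c' (p q : 'I_N) := if p < q then c (p, q) else c (q, p).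
have c'sym p q : c' p q = c' q p.
  by rewrite /c'; case: ltngtP => // /val_inj->.
have [|S [d [hS Hd]]] := HN 'I_N c' c'sym; first by rewrite card_ord.
pose f := [ffun x : T => enum_val (widen_ord hS (enum_rank x))].
have finj : injective f.
  by move=> x y; rewrite !ffunE => /enum_val_inj/(congr1 val)/= /ord_inj/enum_rank_inj.
exists (fun x => h (f, x)); split.
  by move=> i x y e; apply: hom; rewrite /E0 eqxx e /= andbT; apply/injectiveP.
exists d => x y e.
have fS z : f z \in S by rewrite ffunE enum_valP.
wlog lt : x y e / f x < f y => [wl|].
  case: (ltngtP (f x) (f y)) => [lt|gt|]; first exact: wl.
    by rewrite chisym; apply: wl => //; rewrite Esym.
  by move/ord_inj/finj => exy; rewrite exy Eirr in e.
have <- : c' (f x) (f y) = d by apply: Hd; rewrite ?fS // -val_eqE /= ltn_eqF.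
rewrite (Hc (f, x) (f, y)).
- by rewrite /part /c' lt.
- by rewrite /part mem_filter mem_enum lt.
- by rewrite /E0 eqxx e /= andbT; apply/injectiveP.
Qed.

Lemma edge_ramsey_coloring (T K C : finType) (c0 : C) (k : nat) (E : K -> rel T) :
  2 < k -> kfree_coloring k E ->
  exists (T' : finType) (E' : K -> rel T'), kfree_coloring k E' /\
   forall chi : T' -> T' -> C, (forall x y, chi x y = chi y x) ->
     exists h : T -> T', edge_hom E E' h /\
     exists d : K -> C, forall j x y, E j x y -> chi (h x) (h y) = d j.
Proof.
move=> k3 Ef.
suff [T' [E' [Ef' H']]] : exists (T' : finType) (E' : K -> rel T'), kfree_coloring k E' /\
   forall chi : T' -> T' -> C, (forall x y, chi x y = chi y x) ->
     exists h : T -> T', edge_hom E E' h /\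
     exists d : K -> C, forall j x y, j \in enum K -> E j x y -> chi (h x) (h y) = d j.
  exists T', E'; split=> // chi /H'[h [hom [d Hd]]]; exists h; split=> //.
  by exists d => j x y; apply: Hd; rewrite mem_enum.
elim: (enum K) T E Ef => [|i s IH] T E Ef.
  by exists T, E; split=> // chi _; exists id; split=> //; exists (fun=> c0).
have [T1 [E1 [Ef1 H1]]] := edge_ramsey_color c0 i k3 Ef.
have [T2 [E2 [Ef2 H2]]] := IH T1 E1 Ef1.
exists T2, E2; split=> // chi chisym; have [h2 [hom2 [d2 Hd2]]] := H2 chi chisym.
have [x y|h1 [hom1 [d1 Hd1]]] := H1 (fun x y => chi (h2 x) (h2 y)); first exact: chisym.
exists (h2 \o h1); split; first by move=> j x y /hom1/hom2.
exists (fun j => if j == i then d1 else d2 j) => j x y.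
rewrite inE; case: eqP => [-> _|_ /= js] e; first exact: Hd1.
exact/Hd2/hom1.
Qed.

(** * Counting coordinates of a random outcome *)

(** The union bound. Probabilities appear as numbers of outcomes, with denominators cleared. *)
Lemma card_exists_le (W D : finType) (F : {set D}) (P : D -> pred W) :
  #|[set w | [exists a in F, P a w]]| <= \sum_(a in F) #|[set w | P a w]|.
Proof.
apply: (@leq_trans #|\bigcup_(a in F) [set w | P a w]|).
  apply: subset_leq_card; apply/subsetP => w; rewrite inE.
  by case/exists_inP => a aF Pa; apply/bigcupP; exists a; rewrite ?inE.
elim/big_rec2: _ => [|a n A aF IH]; first by rewrite cards0.
by rewrite (leq_trans (leq_card_setU _ _)) // leq_add2l.
Qed.

Lemma card_exists_le_cst (W D : finType) (F : {set D}) (P : D -> pred W) (b c : nat) :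
  (forall a, a \in F -> #|[set w | P a w]| * b <= c) ->
  #|[set w | [exists a in F, P a w]]| * b <= #|F| * c.
Proof.
move=> h; apply: leq_trans (leq_mul (card_exists_le F P) (leqnn b)) _.
by rewrite big_distrl -sum_nat_const; apply: leq_sum.
Qed.

Lemma subset_card_exists (T : finType) (A : {set T}) (k : nat) :
  k <= #|A| -> exists2 B : {set T}, B \subset A & #|B| = k.
Proof.
move=> kA; exists [set x in take k (enum A)].
  by apply/subsetP => x; rewrite inE => /mem_take; rewrite mem_enum.
rewrite cardsE (card_uniqP _) ?take_uniq ?enum_uniq // size_takel //.
by rewrite -cardE.
Qed.

Lemma superset_card_exists (T : finType) (A B : {set T}) (k : nat) :
  A \subset B -> #|A| <= k <= #|B| ->
  exists C : {set T}, [/\ A \subset C, C \subset B & #|C| = k].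
Proof.
move=> AB /andP[Ak kB].
have [|D DBA cD] := @subset_card_exists _ (B :\: A) (k - #|A|).
  by rewrite cardsD (setIidPr AB) leq_sub2r.
exists (A :|: D); split; first exact: subsetUl.
  by rewrite subUset AB (subset_trans DBA) // subsetDl.
rewrite cardsU (_ : A :&: D = set0) ?cards0 ?subn0 ?cD ?subnKC //.
apply/setP => x; rewrite !inE; apply/negP => /andP[xA xD].
by move/subsetP: DBA => /(_ x xD); rewrite !inE xA.
Qed.

Lemma bin_le_exp n k : 'C(n, k) <= n ^ k.
Proof.
apply: (@leq_trans (n ^_ k)).
  by rewrite -bin_ffact leq_pmulr // fact_gt0.
by elim: k => // k IH; rewrite ffactnSr expnSr leq_mul // leq_subr.
Qed.

Lemma bin_le_exp2 n k : 'C(n, k) <= 2 ^ n.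
Proof.
rewrite -[X in X ^ n]/(1 + 1) expnDn.
have [kn|nk] := leqP k n; last by rewrite bin_small.
rewrite (bigD1 (Ordinal (kn : k < n.+1))) //= !exp1n !muln1; exact: leq_addr.
Qed.

(* The binomial coefficient C(2k, k) is at most 4^k and at least k^k / k!. *)
Lemma exp_le_fact k : k ^ k <= 4 ^ k * k`!.
Proof.
apply: (@leq_trans ((2 * k) ^_ k)).
  have h j : j <= k -> k ^ j <= (2 * k) ^_ j.
    elim: j => // j IH jk; rewrite expnSr ffactnSr leq_mul ?IH ?(ltnW jk) //.
    by rewrite leq_subRL ?mul2n -?addnn ?leq_add // ?(ltnW jk) // (leq_trans (ltnW jk)) // leq_addr.
  exact: h.
by rewrite -bin_ffact leq_mul2r -(expnM 2 2 k) bin_le_exp2 orbT.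
Qed.

(** The usual bound (e F / k)^k with 4 in place of e. *)
Lemma bin_exp_le F k : 'C(F, k) * k ^ k <= (4 * F) ^ k.
Proof.
apply: leq_trans (leq_mul (leqnn _) (exp_le_fact k)) _.
rewrite expnMn mulnCA leq_mul2l bin_ffact; apply/orP; right.
by elim: k => // k IH; rewrite ffactnSr expnSr leq_mul // leq_subr.
Qed.

Section Counting.
Variables (I : finType) (Q m : nat).
Local Notation Omega := {ffun I -> 'I_Q}.

(** Coordinates are independent: the event has probability (|D| / Q)^|A|. *)
Lemma card_coords_in (A : {set I}) (D : {set 'I_Q}) :
  #|[set w : Omega | [forall x in A, w x \in D]]| * Q ^ #|A| =
  #|D| ^ #|A| * Q ^ #|I|.
Proof.
pose F x : {set 'I_Q} := if x \in A then D else setT.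
have -> : [set w : Omega | [forall x in A, w x \in D]] = [set w | w \in family F].
  apply/setP => w; rewrite !inE; apply/forall_inP/familyP => h x.
    by rewrite /F; case: ifP => [/h//|]; rewrite inE.
  by move=> xA; have := h x; rewrite /F xA.
rewrite cardsE card_family foldrE big_map big_enum /= (bigID (mem A)) /=.
rewrite (eq_bigr (fun=> #|D|)) => [|x xA]; last by rewrite /F xA.
rewrite [X in _ * X * _](eq_bigr (fun=> Q)) => [|x /negbTE xA]; last by rewrite /F xA cardsT card_ord.
rewrite !prod_nat_const -mulnA -expnD; congr (_ * _ ^ _).
by rewrite -(cardC A) addnC; congr (_ + _); apply: eq_card.
Qed.

Hypothesis mQ : m <= Q.

Definition all_on (w : Omega) (A : {set I}) := [forall x in A, w x < m].

Lemma card_all_on (A : {set I}) :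
  #|[set w | all_on w A]| * Q ^ #|A| = m ^ #|A| * Q ^ #|I|.
Proof.
have cm : #|[set a : 'I_Q | a < m]| = m.
  rewrite -[RHS]card_ord -cardsT -(@card_imset _ _ (widen_ord mQ)); last by move=> a b /(congr1 val)/= /val_inj.
  apply: eq_card => a; rewrite inE; apply/idP/imsetP => [am|[b _ ->]]; last exact: (ltn_ord b).
  by exists (Ordinal am) => //; apply: val_inj.
rewrite -{1}cm -card_coords_in; congr (_ * _); apply: eq_card => w.
by rewrite !inE; apply: eq_forallb => x; rewrite inE.
Qed.

(* The first moment bound, for [k] events which depend on disjoint sets of [b]
   coordinates. *)
Lemma card_disjoint_on (F : {set {set I}}) (b k : nat) :
  (forall A : {set I}, A \in F -> #|A| = b) ->
  #|[set w | [exists S : {set {set I}},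
       [&& S \subset F, #|S| == k, trivIset S & [forall A in S, all_on w A]]]]|
    * Q ^ (b * k) <= 'C(#|F|, k) * (m ^ (b * k) * Q ^ #|I|).
Proof.
move=> Fb; rewrite -(cards_draws F k).
set D := [set S : {set {set I}} | S \subset F & #|S| == k].
apply: (@leq_trans (#|[set w | [exists S in D, trivIset S && all_on w (cover S)]]| * Q ^ (b * k))).
  rewrite leq_mul2r; apply/orP; right; apply: subset_leq_card; apply/subsetP => w.
  rewrite !inE => /existsP[S /and4P[SF Sk St /forall_inP So]].
  apply/existsP; exists S; rewrite inE SF Sk St /=; apply/forall_inP => x /bigcupP[A AS xA].
  by have /forall_inP := So A AS; apply.
apply: card_exists_le_cst => S; rewrite inE => /andP[SF /eqP Sk].
case St: (trivIset S); last by rewrite (_ : [set w | _] = set0) ?cards0 //; apply/setP => w; rewrite !inE.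
have <- : #|cover S| = b * k.
  rewrite -(eqP St) (eq_bigr (fun=> b)) => [|A AS]; last exact/Fb/(subsetP SF).
  by rewrite sum_nat_const Sk mulnC.
by rewrite -card_all_on /=.
Qed.

Lemma card_many_on (A : {set I}) (k : nat) :
  #|[set w : Omega | k <= #|[set x in A | w x < m]|]| * Q ^ k
    <= 'C(#|A|, k) * (m ^ k * Q ^ #|I|).
Proof.
rewrite -(cards_draws A k); set D := [set B : {set I} | B \subset A & #|B| == k].
apply: (@leq_trans (#|[set w | [exists B in D, all_on w B]]| * Q ^ k)).
  rewrite leq_mul2r; apply/orP; right; apply: subset_leq_card; apply/subsetP => w.
  rewrite !inE => /subset_card_exists[B BA Bk]; apply/existsP; exists B.
  rewrite inE Bk eqxx andbT; apply/andP; split.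
    by apply: subset_trans BA _; apply/subsetP => x; rewrite inE => /andP[].
  by apply/forall_inP => x /(subsetP BA); rewrite inE => /andP[].
by apply: card_exists_le_cst => B; rewrite inE => /andP[_ /eqP <-]; rewrite card_all_on.
Qed.

End Counting.

(** * Events revealed row by row *)

Section Sequential.
Variables (B V : finType) (Q : nat).
Hypothesis Q_gt0 : 0 < Q.
Local Notation Omega := {ffun B * V -> 'I_Q}.

Definition update_row (w : Omega) (j : B) (b : {ffun V -> 'I_Q}) : Omega :=
  [ffun p => if p.1 == j then b p.2 else w p].

Definition get_row (w : Omega) (j : B) : {ffun V -> 'I_Q} := [ffun x => w (j, x)].

(** Swapping row [j] of [w] with a fresh row is an involution, so pairs of an outcome and a row may
    be counted after the swap, where row [j] is random and the rest of [w] is fixed. *)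
Lemma resample_row (j : B) (P F : pred Omega) :
  (forall w b, P (update_row w j b) = P w) ->
  (forall w, P w -> #|[set b | F (update_row w j b)]| * 2 <= Q ^ #|V|) ->
  #|[set w | P w && F w]| * 2 <= #|[set w | P w]|.
Proof.
move=> Pinv PF.
have cR : #|[set: {ffun V -> 'I_Q}]| = Q ^ #|V| by rewrite cardsT card_ffun card_ord.
have R0 : 0 < Q ^ #|V| by rewrite expn_gt0 Q_gt0.
rewrite -(leq_pmul2r R0) -{1}cR mulnAC -cardsX.
pose phi (u : Omega * {ffun V -> 'I_Q}) := (update_row u.1 j u.2, get_row u.1 j).
have phiK : involutive phi.
  move=> [w b]; congr (_, _); apply/ffunP.
    by move=> [j' x]; rewrite !ffunE /=; case: eqP => // ->.
  by move=> x; rewrite !ffunE /= eqxx.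
rewrite -(card_imset _ (inv_inj phiK)).
set A := _ @: _.
have -> : #|A| = \sum_(w | P w) #|[set b | F (update_row w j b)]|.
  transitivity (\sum_(w | P w) \sum_(b | F (update_row w j b)) 1).
    rewrite pair_big_dep /= sum1_card; apply: eq_card => -[w b].
    rewrite -[in LHS](phiK (w, b)) mem_imset ?inE /=; last exact: inv_inj.
    by rewrite Pinv andbT.
  by apply: eq_bigr => w _; rewrite sum1_card cardsE.
rewrite big_distrl /= cardsE -sum_nat_const; apply: leq_sum => w; exact: PF.
Qed.

Variable rk : B -> nat.
Hypothesis rk_inj : injective rk.
Variables (cond fail : Omega -> B -> bool).
Hypothesis cond_past : forall (j : B) (w w' : Omega),
  (forall p, rk p.1 < rk j -> w p = w' p) -> cond w j = cond w' j.
Hypothesis fail_past : forall (j : B) (w w' : Omega),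
  (forall p, rk p.1 <= rk j -> w p = w' p) -> fail w j = fail w' j.
Hypothesis fail_half : forall w j, cond w j ->
  #|[set b | fail (update_row w j b) j]| * 2 <= Q ^ #|V|.

(** Induction, removing the [j] of largest rank: neither [cond w j] nor the other events look at row
    [j], so its failure halves the count. *)
Lemma sequential_fail (S : {set B}) :
  #|[set w | [forall j in S, cond w j && fail w j]]| * 2 ^ #|S| <= #|{: Omega}|.
Proof.
have [n] := ubnP #|S|; elim: n S => // n IH S.
have [->|/set0Pn[j0 j0S]] := eqVneq S set0.
  by rewrite cards0 muln1 => _; apply: max_card.
have [j jS jmax] := @arg_maxnP _ j0 (fun x => x \in S) rk j0S.
move=> hS; pose S' := S :\ j.
have cS : #|S| = #|S'|.+1 by rewrite (cardsD1 j S) jS.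
apply: leq_trans (IH S' _); last by rewrite -ltnS -cS.
rewrite cS expnS mulnA leq_mul2r; apply/orP; right.
pose P w := [forall j' in S', cond w j' && fail w j'] && cond w j.
apply: (@leq_trans (#|[set w | P w && fail w j]| * 2)).
  rewrite leq_mul2r /=; apply: subset_leq_card; apply/subsetP => w; rewrite !inE.
  move=> /forall_inP h; rewrite /P -andbA (h j jS) andbT.
  by apply/forall_inP => j' /setD1P[_ /h].
apply: leq_trans (subset_leq_card _); first apply: (@resample_row j).
- move=> w b.
  have upd p : p.1 != j -> update_row w j b p = w p by move=> pj; rewrite ffunE (negbTE pj).
  rewrite /P (cond_past (w' := w)); last first.
    by move=> p hp; rewrite upd //; apply: contraTneq hp => ->; rewrite ltnn.
  congr (_ && _); apply: eq_forallb => j'; case jS': (j' \in S') => //=.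
  have lt : rk j' < rk j.
    move: jS'; rewrite !inE => /andP[nj /jmax hle].
    by rewrite ltn_neqAle (inj_eq rk_inj) nj; exact: hle.
  rewrite (cond_past (w' := w)) ?(fail_past (w' := w)) //.
    move=> p hp; rewrite upd //; apply: contraTneq hp => ->; by rewrite -ltnNge.
  move=> p hp; rewrite upd //; apply: contraTneq hp => ->; by rewrite -leqNgt ltnW.
- by move=> w /andP[_ /fail_half].
by apply/subsetP => w; rewrite !inE => /andP[].
Qed.

End Sequential.

(** * Colour patterns from families of blocks *)

Section Pattern.
Variables (B V K : finType) (Q m : nat) (col : B -> K) (rk : B -> nat).
Hypothesis rk_inj : injective rk.
Local Notation Omega := {ffun B * V -> 'I_Q}.
Implicit Type w : Omega.

(** The value [w (j, x)] encodes two choices: if it is below [m], then [x] is in block [j] and the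
    value is its part. *)
Definition in_block w j x := w (j, x) < m.

Definition covered w i l x y :=
  [exists j, [&& col j == i, rk j < l, in_block w j x & in_block w j y]].

(** Joining [x] and [y] would close a triangle through [d] with two different earlier blocks of
    colour [i]. *)
Definition cherry w i l x y :=
  [exists j1, exists j2, exists d,
    [&& [&& col j1 == i, rk j1 < l, in_block w j1 x & in_block w j1 d],
        [&& col j2 == i, rk j2 < l, in_block w j2 y & in_block w j2 d] & j1 != j2]].

Definition clean w j x :=
  [forall u, in_block w j u ==> (u != x) ==> ~~ covered w (col j) (rk j) x u].

(* [clean] ensures that no edge between two vertices of a clique in the block
   [j] comes from an earlier block of the same colour. *)
Definition block_edge w j x y :=
  [&& x != y, [&& in_block w j x, in_block w j y & w (j, x) != w (j, y)],
      clean w j x && clean w j y,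
      [forall i, ~~ covered w i (rk j) x y] & ~~ cherry w (col j) (rk j) x y].

Definition pattern_edges w i : rel V := fun x y =>
  [exists j, (col j == i) && block_edge w j x y].

Lemma covered_sym w i l x y : covered w i l x y = covered w i l y x.
Proof. by apply: eq_existsb => j; rewrite [in_block w j x && _]andbC. Qed.

Lemma cherry_sym w i l x y : cherry w i l x y -> cherry w i l y x.
Proof.
case/existsP => j1 /existsP[j2 /existsP[d /and3P[h1 h2 h12]]].
apply/existsP; exists j2; apply/existsP; exists j1; apply/existsP; exists d.
by rewrite h1 h2 eq_sym.
Qed.

Lemma block_edge_sym w j x y : block_edge w j x y -> block_edge w j y x.
Proof.
case/and5P => xy /and3P[jx jy wxy] /andP[cx cy] /forallP cov ch.
rewrite /block_edge eq_sym xy jx jy eq_sym wxy cx cy /=; apply/andP; split.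
  by apply/forallP => i; rewrite covered_sym.
by apply: contra ch; apply: cherry_sym.
Qed.

Lemma covered_block w j x y l : in_block w j x -> in_block w j y -> rk j < l -> covered w (col j) l x y.
Proof. by move=> jx jy lt; apply/existsP; exists j; rewrite eqxx lt jx jy. Qed.

Lemma block_edge_uniq w j j' x y : block_edge w j x y -> block_edge w j' x y -> j = j'.
Proof.
case/and5P => _ /and3P[jx jy _] _ /forallP cov _.
case/and5P => _ /and3P[jx' jy' _] _ /forallP cov' _.
apply: rk_inj; case: (ltngtP (rk j) (rk j')) => // lt.
  by have /negP[] := cov' (col j); apply: covered_block.
by have /negP[] := cov (col j'); apply: covered_block.
Qed.

(** Let [(a, b)] be an edge of the clique whose block [j] is latest. A vertex outside [j] would be
    joined to [a] and [b] in one earlier block, which then covers the pair, or in two, which form a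
    cherry. Cleanness puts all edges in [j], where [m + 1] vertices cannot have distinct parts. *)
Lemma pattern_free w : 0 < m -> kfree_coloring m.+1 (pattern_edges w).
Proof.
move=> m_gt0; split.
- move=> i x y; apply: eq_existsb => j.
  by case: eqP => //= _; apply/idP/idP; apply: block_edge_sym.
- by move=> i x; apply/existsP => -[j /andP[_ /and5P[]]]; rewrite eqxx.
- move=> i i' x y /existsP[j /andP[/eqP<- e]] /existsP[j' /andP[/eqP<- e']].
  by rewrite (block_edge_uniq e e').
move=> i g cl.
pose a0 : 'I_m.+1 := ord0; pose b0 : 'I_m.+1 := ord_max.
have ab0 : a0 != b0 by rewrite -val_eqE /= eq_sym -lt0n.
have /existsP[j0 _] := cl _ _ ab0.
have [F FP] : exists F : 'I_m.+1 * 'I_m.+1 -> B, forall u, u.1 != u.2 ->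
    col (F u) = i /\ block_edge w (F u) (g u.1) (g u.2).
  exists (fun u => odflt j0 [pick j | (col j == i) && block_edge w j (g u.1) (g u.2)]).
  move=> u /cl /existsP[j hj]; case: pickP => [j' /andP[/eqP]//|/(_ j)].
  by rewrite hj.
have [[a b] /= ab max] :=
  @arg_maxnP _ (a0, b0) (fun u => u.1 != u.2) (fun u => rk (F u)) ab0.
set j := F (a, b) in max.
have {}max u v : u != v -> F (u, v) != j -> rk (F (u, v)) < rk j.
  move=> uv nj; rewrite ltn_neqAle (inj_eq rk_inj) nj; exact: (max (u, v)).
have [cj ej] := FP (a, b) ab; rewrite -/j /= in cj ej.
have /and5P[_ /and3P[ja jb _] /andP[ca cb] /forallP ncov nch] := ej.
have on_j u : in_block w j (g u).
  have [->//|ua] := eqVneq u a; have [->//|ub] := eqVneq u b.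
  have [c1 /= e1] := FP (u, a) ua; have [c2 /= e2] := FP (u, b) ub.
  have /and5P[_ /and3P[u1 a1 _] _ _ _] := e1.
  have /and5P[_ /and3P[u2 b2 _] _ _ _] := e2.
  have [<-//|/(max _ _ ua) lt1] := eqVneq (F (u, a)) j.
  have [<-//|/(max _ _ ub) lt2] := eqVneq (F (u, b)) j.
  have [e12|n12] := eqVneq (F (u, a)) (F (u, b)).
    have /negP[] := ncov (col (F (u, a))); apply: covered_block => //.
    by rewrite e12.
  case/negP: nch; apply/existsP; exists (F (u, a)); apply/existsP; exists (F (u, b)).
  by apply/existsP; exists (g u); rewrite cj c1 c2 eqxx lt1 lt2 a1 u1 b2 u2.
(* No edge at a clean vertex comes from an earlier block. As [a] is clean, its edges lie in [j], and
   so their other ends are clean too. *)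
have at_j u v : u != v -> clean w j (g u) -> F (u, v) = j.
  move=> uv /forallP/(_ (g v)); rewrite on_j /=.
  have [c1 /= e1] := FP (u, v) uv.
  have /and5P[guv /and3P[u1 v1 _] _ _ _] := e1.
  rewrite eq_sym guv /= => ncv; apply/eqP; apply: contraT => /(max _ _ uv) lt.
  by case/negP: ncv; rewrite cj -c1; apply: covered_block.
have clean_j u : clean w j (g u).
  have [->//|ua] := eqVneq u a.
  have [_ /= e1] := FP (a, u) (ltac:(by rewrite eq_sym)).
  have /and5P[_ _ /andP[_]] := e1; by rewrite at_j // eq_sym.
pose lab u : 'I_m := Ordinal (on_j u).
have labi : injective lab.
  move=> u v; move/(congr1 val) => /= /val_inj luv; apply/eqP; apply: contraT => uv.
  have [_ /=] := FP (u, v) uv; rewrite at_j // => /and5P[_ /and3P[_ _]].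
  by rewrite luv eqxx.
by have := leq_card _ labi; rewrite !card_ord ltnn.
Qed.

(* If the block [j] contains no bad pair, then all its vertices in [X] are clean
   and no pair of them is excluded. *)
Definition bad_pairs w (X : {set V}) (j : B) : {set V * V} :=
  [set p | [&& p.1 != p.2, p.1 \in X &
    covered w (col j) (rk j) p.1 p.2 ||
    (p.2 \in X) && ([exists i, covered w i (rk j) p.1 p.2] ||
                   cherry w (col j) (rk j) p.1 p.2)]].

Definition block_fail w (X : {set V}) (j : B) :=
  [exists p in bad_pairs w X j, in_block w j p.1 && in_block w j p.2] ||
  [exists a : 'I_m, [forall x in X, val (w (j, x)) != a]].

Lemma bad_pairs_past w w' X j : (forall p, rk p.1 < rk j -> w p = w' p) ->
  bad_pairs w X j = bad_pairs w' X j.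
Proof.
move=> ww'.
have E j' x : rk j' < rk j -> in_block w j' x = in_block w' j' x.
  by move=> lt; rewrite /in_block ww'.
have cov i x y : covered w i (rk j) x y = covered w' i (rk j) x y.
  by apply: eq_existsb => j'; case: ltnP => lt; rewrite ?andbF //= !E.
apply/setP => -[x y]; rewrite !inE /= cov.
have -> : [exists i, covered w i (rk j) x y] = [exists i, covered w' i (rk j) x y].
  exact: eq_existsb.
suff -> : cherry w (col j) (rk j) x y = cherry w' (col j) (rk j) x y by [].
apply: eq_existsb => j1; apply: eq_existsb => j2; apply: eq_existsb => d.
by case: (ltnP (rk j1)) => l1; case: (ltnP (rk j2)) => l2; rewrite ?andbF //= !E.
Qed.

Lemma block_fail_past w w' X j : (forall p, rk p.1 <= rk j -> w p = w' p) ->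
  block_fail w X j = block_fail w' X j.
Proof.
move=> ww'; rewrite /block_fail (@bad_pairs_past w w'); last by move=> p /ltnW/ww'.
congr (_ || _); first by apply: eq_existsb => p; rewrite /in_block !ww'.
by apply: eq_existsb => a; apply: eq_forallb => x; rewrite ww'.
Qed.

(** One vertex of [X] is taken from each of the [m] parts; without bad pairs in the block, any two
    of them are joined. *)
Lemma block_clique w X j : ~~ block_fail w X j ->
  exists g : 'I_m -> V, clique_map (pattern_edges w (col j)) g /\ forall a, g a \in X.
Proof.
rewrite negb_or => /andP[/existsPn nbad /existsPn lab].
have [g gP] : exists g : 'I_m -> V, forall a, g a \in X /\ val (w (j, g a)) = a.
  have H (a : 'I_m) : exists x, (x \in X) && (val (w (j, x)) == a).
    have /forall_inPn[x xX /negPn hx] := lab a; by exists x; rewrite xX.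
  by exists (fun a => xchoose (H a)) => a; have /andP[? /eqP] := xchooseP (H a).
have ong a : in_block w j (g a) by rewrite /in_block (gP a).2.
have nb x y : x != y -> x \in X -> in_block w j x -> in_block w j y -> (x, y) \notin bad_pairs w X j.
  move=> _ _ jx jy; have := nbad (x, y); by rewrite /= jx jy !andbT.
have gcl a : clean w j (g a).
  apply/forallP => u; apply/implyP => ju; apply/implyP => nu.
  have := nb (g a) u; rewrite inE /= eq_sym nu (gP a).1 ong ju => /(_ isT isT isT isT).
  by rewrite negb_or => /andP[].
exists g; split=> [a b ab|a]; last by case: (gP a).
apply/existsP; exists j; rewrite eqxx /=.
have wab : w (j, g a) != w (j, g b) by rewrite -val_eqE (gP a).2 (gP b).2.
have gab : g a != g b by apply: contraNneq wab => ->.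
rewrite /block_edge gab !ong wab !gcl /=.
have := nb (g a) (g b) gab (gP a).1 (ong a) (ong b).
by rewrite inE /= gab (gP a).1 (gP b).1 /= !negb_or negb_exists => /and3P[_ -> ->].
Qed.

Hypotheses (Q_gt0 : 0 < Q) (mQ : m <= Q).

(** Each way to fail has probability at most 1/4: [F1] puts a bad pair in the block, [F2] leaves a
    part without vertices of [X]. The bad pairs depend on earlier blocks only, so they are fixed
    while row [j] varies. *)
Lemma card_block_fail (w0 : Omega) (X : {set V}) (j : B) :
  #|bad_pairs w0 X j| * (4 * m ^ 2) <= Q ^ 2 ->
  4 * m * Q.-1 ^ #|X| <= Q ^ #|X| ->
  #|[set b | block_fail (update_row w0 j b) X j]| * 2 <= Q ^ #|V|.
Proof.
move=> hbad hlab.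
pose F1 : {set {ffun V -> 'I_Q}} :=
  [set b : {ffun V -> 'I_Q} | [exists p in bad_pairs w0 X j, all_on m b [set p.1; p.2]]].
pose F2 : {set {ffun V -> 'I_Q}} :=
  [set b : {ffun V -> 'I_Q} | [exists a in [set: 'I_m], [forall x in X, b x \in ~: [set widen_ord mQ a]]]].
have bE (b : {ffun V -> 'I_Q}) p : in_block (update_row w0 j b) j p = (b p < m) by rewrite /in_block ffunE eqxx.
have sub : [set b | block_fail (update_row w0 j b) X j] \subset F1 :|: F2.
  apply/subsetP => b; rewrite !inE => /orP[/existsP[p /andP[pb]]|/existsP[a /forall_inP h]].
    rewrite !bE => /andP[h1 h2]; apply/orP; left; apply/existsP; exists p.
    apply/andP; split; last by apply/forall_inP => x /set2P[]->.
    rewrite -(@bad_pairs_past (update_row w0 j b) w0) // => q hq.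
    by rewrite ffunE; case: eqP hq => // ->; rewrite ltnn.
  apply/orP; right; apply/existsP; exists a; rewrite inE; apply/forall_inP => x /h.
  by rewrite ffunE /= eqxx !inE -val_eqE.
have c1 : #|F1| * 4 <= Q ^ #|V|.
  have : #|F1| * Q ^ 2 <= #|bad_pairs w0 X j| * (m ^ 2 * Q ^ #|V|).
    apply: card_exists_le_cst => p; rewrite inE => /andP[np _].
    by have := card_all_on mQ [set p.1; p.2]; rewrite cards2 np => ->.
  move=> h; rewrite -(@leq_pmul2r (Q ^ 2)) ?expn_gt0 ?Q_gt0 // mulnAC.
  apply: leq_trans (leq_mul h (leqnn 4)) _.
  rewrite [X in _ <= X]mulnC; apply: leq_trans (leq_mul hbad (leqnn _)).
  rewrite -!mulnA; apply: leq_mul => //.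
  by rewrite [X in _ <= X]mulnC -!mulnA.
have c2 : #|F2| * 4 <= Q ^ #|V|.
  have : #|F2| * Q ^ #|X| <= #|[set: 'I_m]| * (Q.-1 ^ #|X| * Q ^ #|V|).
    apply: card_exists_le_cst => a _.
    by rewrite card_coords_in cardsC1 card_ord.
  rewrite cardsT card_ord => h.
  rewrite -(@leq_pmul2r (Q ^ #|X|)) ?expn_gt0 ?Q_gt0 // mulnAC.
  apply: leq_trans (leq_mul h (leqnn 4)) _.
  rewrite [X in _ <= X]mulnC; apply: leq_trans (leq_mul hlab (leqnn _)).
  by rewrite [_ * 4]mulnC !mulnA.
apply: leq_trans (leq_mul (subset_leq_card sub) (leqnn 2)) _.
apply: leq_trans (leq_mul (leq_card_setU _ _) (leqnn 2)) _.
rewrite -(@leq_pmul2r 2) // -mulnA (_ : 2 * 2 = 4) // mulnDl [X in _ <= X]mulnC mul2n -addnn.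
exact: leq_add.
Qed.

End Pattern.

(** * Few bad pairs in a pseudo-random outcome *)

Lemma leq_card_bigcup (D W : finType) (A : {pred D}) (F : D -> {set W}) :
  #|\bigcup_(a in A) F a| <= \sum_(a in A) #|F a|.
Proof.
elim/big_rec2: _ => [|a n S aA IH]; first by rewrite cards0.
by rewrite (leq_trans (leq_card_setU _ _)) // leq_add2l.
Qed.

Lemma sum_nat_of_bool (I : finType) (A P : {pred I}) :
  \sum_(x in A) (P x : nat) = #|[set x in A | P x]|.
Proof.
rewrite -sum1_card big_mkcond [RHS]big_mkcond /=; apply: eq_bigr => x _.
by rewrite inE; case: (x \in A) => //=; case: (P x).
Qed.

Lemma top_sum (I : finType) (A : {set I}) (z g : I -> nat) (s M : nat) :
  {in A, forall j, z j <= s} -> \sum_(j in A) z j <= s * M -> M <= #|A| ->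
  exists T : {set I}, [/\ T \subset A, #|T| = M &
    \sum_(j in A) z j * g j <= s * \sum_(j in T) g j].
Proof.
move=> zs zM MA; pose P (T : {set I}) := (T \subset A) && (#|T| == M).
have [T0 T0A cT0] := subset_card_exists MA.
have PT0 : P T0 by rewrite /P T0A cT0 eqxx.
have [T /andP[TA /eqP cT] Tmax] := @arg_maxnP _ T0 P (fun T => \sum_(j in T) g j) PT0.
exists T; split=> //.
(* [T] consists of the [M] largest values of [g], so moving the weight [z] onto
   [T] up to the bound [s] does not decrease the sum. *)
have exch a b : a \in T -> b \in A -> b \notin T -> g b <= g a.
  move=> aT bA bT.
  have bTa : b \notin T :\ a by rewrite !inE (negbTE bT) andbF.
  have := Tmax (b |: (T :\ a)); rewrite /P => /(_ _)/= h.
  have : \sum_(j in b |: T :\ a) g j <= \sum_(j in T) g j.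
    apply: h; rewrite subUset sub1set bA (subset_trans (subsetDl _ _)) //=.
    by rewrite cardsU1 bTa -cT (cardsD1 a T) aT.
  by rewrite big_setU1 //= (big_setD1 a aT) /= leq_add2r.
have split_sum (f : I -> nat) : \sum_(j in A) f j = \sum_(j in T) f j + \sum_(j in A :\: T) f j.
  by rewrite (big_setID T) /= (setIidPr TA).
have [T0'|/set0Pn[a0 a0T]] := eqVneq T set0.
  have M0 : M = 0 by rewrite -cT T0' cards0.
  rewrite T0' big_set0 muln0 leqn0 sum_nat_eq0; apply/forall_inP => j jA.
  by move: zM; rewrite M0 muln0 leqn0 sum_nat_eq0 => /forall_inP/(_ j jA)/eqP->.
have [a aT amin] := @arg_minnP _ a0 (fun x => x \in T) g a0T.
have zT : \sum_(j in T) z j + \sum_(j in T) (s - z j) = s * M.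
  rewrite -big_split /= -cT mulnC -sum_nat_const; apply: eq_bigr => j jT.
  by rewrite subnKC // zs // (subsetP TA).
have h1 : \sum_(j in A :\: T) z j <= \sum_(j in T) (s - z j).
  by rewrite -(leq_add2l (\sum_(j in T) z j)) zT -split_sum.
rewrite split_sum.
have -> : s * \sum_(j in T) g j = \sum_(j in T) z j * g j + \sum_(j in T) (s - z j) * g j.
  rewrite big_distrr -big_split /=; apply: eq_bigr => j jT.
  by rewrite -mulnDl subnKC // zs // (subsetP TA).
rewrite leq_add2l; apply: (@leq_trans (\sum_(j in A :\: T) z j * g a)).
  by apply: leq_sum => j /setDP[jA jT]; rewrite leq_mul2l exch ?orbT.
rewrite -big_distrl /=; apply: leq_trans (leq_mul h1 (leqnn _)) _.
rewrite big_distrl; apply: leq_sum => j jT; rewrite leq_mul2l; apply/orP; right; exact: amin.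
Qed.

Section GoodOutcome.
Variables (B V K : finType) (Q m : nat) (col : B -> K) (rk : B -> nat).
Variable w : {ffun B * V -> 'I_Q}.
Variables (s d y t M : nat) (v : nat -> nat).

Local Notation in_block := (in_block m w).

Definition members j : {set V} := [set x | in_block j x].
Definition color_blocks i : {set B} := [set j | col j == i].

Definition small_blocks := forall j, #|members j| <= s.
Definition small_degrees := forall i x, #|[set j in color_blocks i | in_block j x]| <= d.
Definition sparse_incidences := forall (X : {set V}) (T : {set B}),
  #|X| = t -> #|T| = t -> #|[set p in setX T X | w p < m]| < y * t.
(** The quotient is the number of disjoint groups of [b] blocks of [U] through [x]; disjointness
    will make these events independent. *)
Definition sparse_meetings b := forall i (U : {set B}),
  U \subset color_blocks i -> #|U| = 2 * M ->
  \sum_(x : V) #|[set j in U | in_block j x]| %/ b < v b.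

Hypotheses (G1 : small_blocks) (G2 : small_degrees) (G3 : sparse_incidences).
Hypotheses (G4 : sparse_meetings 2) (G5 : sparse_meetings 3).
Hypotheses (sM : t * d <= s * M) (NM : forall i, 2 * M <= #|color_blocks i|).
Hypothesis tB : t <= #|B|.
Variable X : {set V}.
Hypothesis Xt : #|X| = t.

Let z j := #|X :&: members j|.

Lemma z_le j : z j <= s.
Proof. exact: leq_trans (subset_leq_card (subsetIr _ _)) (G1 j). Qed.

Lemma sum_z (A : {set B}) : \sum_(j in A) z j = \sum_(x in X) #|[set j in A | in_block j x]|.
Proof.
transitivity (\sum_(j in A) \sum_(x in X) (in_block j x : nat)).
  by apply: eq_bigr => j _; rewrite sum_nat_of_bool; apply: eq_card => x; rewrite !inE.
by rewrite exchange_big; apply: eq_bigr => x _; rewrite sum_nat_of_bool.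
Qed.

Lemma sum_z_color i : \sum_(j in color_blocks i) z j <= t * d.
Proof.
rewrite sum_z -Xt -sum_nat_const; apply: leq_sum => x _; exact: G2.
Qed.

Lemma sum_z_all : \sum_j z j <= #|K| * (t * d).
Proof.
rewrite (partition_big col xpredT) //= -sum_nat_const; apply: leq_sum => i _.
by apply: leq_trans (sum_z_color i); rewrite leq_eqVlt; apply/orP; left;
   apply/eqP; apply: eq_bigl => j; rewrite inE.
Qed.

(** Fewer than [t] blocks have [y <= z j], since [t] of them would have [y * t] incidences with [X].
    These contribute the second term, the others the first. *)
Lemma sum_z_sq : \sum_j z j ^ 2 <= y * (#|K| * (t * d)) + s * (y * t).
Proof.
pose H : {set B} := [set j | y <= z j].
have cardP (T : {set B}) : #|[set p in setX T X | w p < m]| = \sum_(j in T) z j.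
  rewrite -sum1_card; under [RHS]eq_bigr => j _ do rewrite /z -sum1_card.
  rewrite pair_big_dep /=; apply: eq_bigl => -[j x].
  by rewrite !inE /= andbA.
have cH : #|H| < t.
  rewrite ltnNge; apply/negP => /subset_card_exists[T TH cT].
  have := G3 Xt cT; rewrite cardP ltnNge => /negP; apply.
  rewrite mulnC -cT -sum_nat_const; apply: leq_sum => j /(subsetP TH).
  by rewrite inE.
have zH : \sum_(j in H) z j <= y * t.
  have [||T [HT _ cT]] := @superset_card_exists _ H setT t; rewrite ?subsetT //.
    by rewrite cardsT tB ltnW.
  have := ltnW (G3 Xt cT); rewrite cardP; apply: leq_trans.
  by rewrite [X in _ <= X](big_setID H) /= (setIidPr HT) leq_addr.
rewrite (bigID (mem H)) /= addnC; apply: leq_add.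
  apply: leq_trans (leq_mul (leqnn y) sum_z_all).
  rewrite big_distrr /= [X in _ <= X](bigID (mem H)) /=.
  apply: leq_trans (leq_addl _ _); apply: leq_sum => j; rewrite inE -ltnNge => /ltnW h.
  by rewrite -mulnn leq_mul.
apply: leq_trans (leq_mul (leqnn s) zH).
rewrite big_distrr; apply: leq_sum => j _; by rewrite -mulnn leq_mul // z_le.
Qed.

Definition meet j1 j2 := (j1 != j2) && [exists x, in_block j1 x && in_block j2 x].

(** Meeting pairs are counted at a common vertex: [k x] blocks through [x] give [k x * (k x).-1]
    ordered pairs. Values up to 2 are paid by [v 2], larger ones by [v 3]. *)
Lemma sum_meet i (U : {set B}) : U \subset color_blocks i -> #|U| = 2 * M ->
  \sum_(j1 in U) \sum_(j2 in U) (meet j1 j2 : nat) <= 2 * v 2 + 5 * d * v 3.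
Proof.
move=> UB cU.
pose k x := #|[set j in U | in_block j x]|.
apply: (@leq_trans (\sum_(x : V) k x * (k x).-1)).
  apply: (@leq_trans (\sum_(j1 in U) \sum_(j2 in U) \sum_(x : V)
            ([&& j1 != j2, in_block j1 x & in_block j2 x] : nat))).
    apply: leq_sum => j1 _; apply: leq_sum => j2 _; rewrite /meet.
    case: eqP => //= _; case: existsP => //= -[x hx].
    by rewrite (bigD1 x) //= hx leq_addr.
  under eq_bigr => j1 _ do rewrite exchange_big /=.
  rewrite exchange_big /=; apply: leq_sum => x _.
  rewrite -sum_nat_const big_mkcond [X in _ <= X]big_mkcond /=.
  apply: leq_sum => j1 _; rewrite inE; case j1U: (j1 \in U) => //=.
  case o1: (in_block j1 x); last first.
    by rewrite big1 // => j2 _; rewrite andbF.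
  rewrite sum_nat_of_bool /k [in X in _ <= X](cardsD1 j1) inE j1U o1 add1n /=.
  by apply: subset_leq_card; apply/subsetP => j2; rewrite !inE eq_sym andbCA.
apply: (@leq_trans (\sum_(x : V) (2 * (k x %/ 2) + 5 * d * (k x %/ 3)))).
  apply: leq_sum => x _.
  have kd : k x <= d.
    apply: leq_trans (G2 i x); apply: subset_leq_card; apply/subsetP => j.
    by rewrite !inE => /andP[/(subsetP UB)]; rewrite inE => -> ->.
  have [k2|k3] := leqP (k x) 2.
    by move: k2 kd; case: (k x) => [|[|[|]]] // _ _; rewrite leq_addr.
  apply: (@leq_trans (5 * d * (k x %/ 3))); last exact: leq_addl.
  (* The constant is attained at [k x = 5]. *)
  have h5 : k x <= 5 * (k x %/ 3) by lia.
  by rewrite mulnAC leq_mul // (leq_trans (leq_pred _)).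
rewrite big_split /= -!big_distrr /=.
by apply: leq_add; rewrite leq_mul2l ltnW ?orbT //; [apply: G4 UB cU|apply: G5 UB cU].
Qed.

(** The sum is linear in each of the two factors [z], so [top_sum] applies twice and moves the
    weight to sets [T] and [T'] of [M] blocks, both inside one [U] of size [2 * M]. *)
Lemma sum_z_meet i :
  \sum_(j1 in color_blocks i) \sum_(j2 in color_blocks i) (z j1 * z j2 * meet j1 j2)
  <= s ^ 2 * (2 * v 2 + 5 * d * v 3).
Proof.
have zs : {in color_blocks i, forall j, z j <= s} by move=> j _; apply: z_le.
have zM : \sum_(j in color_blocks i) z j <= s * M by apply: leq_trans (sum_z_color i) sM.
have MN : M <= #|color_blocks i| by apply: leq_trans (NM i); rewrite leq_pmull.
have [T [TA cT hT]] := top_sum (fun j1 => \sum_(j2 in color_blocks i) z j2 * meet j1 j2) zs zM MN.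
have [T' [TA' cT' hT']] := top_sum (fun j2 => \sum_(j1 in T) meet j1 j2) zs zM MN.
have [||U [TU UB cU]] := @superset_card_exists _ (T :|: T') (color_blocks i) (2 * M).
  - by rewrite subUset TA TA'.
  - by rewrite NM andbT (leq_trans (leq_card_setU _ _)) // cT cT' mul2n addnn.
have [TU1 TU2] : T \subset U /\ T' \subset U by apply/andP; rewrite -subUset.
apply: (@leq_trans (\sum_(j1 in color_blocks i) z j1 * \sum_(j2 in color_blocks i) z j2 * meet j1 j2)).
  by apply: leq_sum => j1 _; rewrite big_distrr /=; apply: leq_sum => j2 _; rewrite mulnA.
apply: leq_trans hT _; rewrite -mulnn -mulnA leq_mul2l; apply/orP; right.
rewrite exchange_big /=.
apply: (@leq_trans (\sum_(j2 in color_blocks i) z j2 * \sum_(j1 in T) meet j1 j2)).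
  by apply: leq_sum => j2 _; rewrite big_distrr.
apply: leq_trans hT' _; rewrite leq_mul2l; apply/orP; right.
apply: leq_trans (sum_meet UB cU); rewrite exchange_big /=.
apply: (@leq_trans (\sum_(j1 in T) \sum_(j2 in U) meet j1 j2)).
  apply: leq_sum => j1 _.
  by rewrite [X in _ <= X](big_setID T') /= (setIidPr TU2) leq_addr.
by rewrite [X in _ <= X](big_setID T) /= (setIidPr TU1) leq_addr.
Qed.

(** The three terms bound the pairs covered in the colour of [j], the pairs in [X] covered in any
    colour, and the cherries, whose two blocks meet. *)
Lemma card_bad_pairs j :
  #|bad_pairs m col rk w X j| <= t * d * s + (y * (#|K| * (t * d)) + s * (y * t))
     + s ^ 2 * (2 * v 2 + 5 * d * v 3).
Proof.
pose i := col j.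
pose P1 := \bigcup_(j' in color_blocks i) setX (X :&: members j') (members j').
pose P2 := \bigcup_(j' in [set: B]) setX (X :&: members j') (X :&: members j').
pose P3 := \bigcup_(u in setX (color_blocks i) (color_blocks i))
   (if meet u.1 u.2 then setX (X :&: members u.1) (X :&: members u.2) else set0).
have sub : bad_pairs m col rk w X j \subset P1 :|: P2 :|: P3.
  apply/subsetP => -[a b]; rewrite !inE /= => /and3P[_ aX /orP[/existsP[j' h]|/andP[bX]]].
    move: h => /and4P[cj _ ja jb]; apply/orP; left; apply/orP; left.
    by apply/bigcupP; exists j'; rewrite !inE ?aX ?ja.
  case/orP => [/existsP[i' /existsP[j' /and4P[_ _ ja jb]]]|].
    apply/orP; left; apply/orP; right; apply/bigcupP; exists j'; rewrite !inE //=.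
    by rewrite aX bX ja jb.
  case/existsP => j1 /existsP[j2 /existsP[x /and3P[/and4P[c1 _ a1 x1] /and4P[c2 _ b2 x2] n12]]].
  apply/orP; right; apply/bigcupP; exists (j1, j2); first by rewrite !inE c1 c2.
  rewrite /meet n12 (_ : [exists x, _]) /=; last by apply/existsP; exists x; rewrite x1 x2.
  by rewrite !inE aX bX a1 b2.
apply: leq_trans (subset_leq_card sub) _.
apply: leq_trans (leq_card_setU _ _) _; apply: leq_add.
  apply: leq_trans (leq_card_setU _ _) _; apply: leq_add.
    apply: leq_trans (leq_card_bigcup _ _) _.
    apply: (@leq_trans (\sum_(j' in color_blocks i) z j' * s)).
      by apply: leq_sum => j' _; rewrite cardsX leq_mul2l G1 orbT.
    by rewrite -big_distrl leq_mul2r sum_z_color orbT.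
  apply: leq_trans (leq_card_bigcup _ _) _; apply: leq_trans sum_z_sq.
  rewrite big_mkcond; apply: leq_sum => j' _; by rewrite inE cardsX mulnn.
apply: leq_trans (leq_card_bigcup _ _) _; apply: leq_trans (sum_z_meet i).
rewrite pair_big /=.
rewrite (eq_bigl (fun u => (u.1 \in color_blocks i) && (u.2 \in color_blocks i))); last first.
  by case=> j1 j2; rewrite inE.
apply: leq_sum => -[j1 j2] _ /=; case: ifP => _; first by rewrite cardsX muln1.
by rewrite cards0.
Qed.

End GoodOutcome.

(** * Existence of pseudo-random outcomes *)

(** [k] is at least 8 times the expected number F (m / Q)^b, so (4 F / k)^k (m / Q)^(b k) is at most
    2^(-k). *)
Lemma first_moment (F k b m Q O X : nat) : 0 < k ->
  8 * F * m ^ b <= k * Q ^ b -> X * Q ^ (b * k) <= 'C(F, k) * (m ^ (b * k) * O) ->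
  0 < Q -> X * 2 ^ k <= O.
Proof.
move=> k0 hF hX Q0.
have P0 : 0 < k ^ k * Q ^ (b * k) by rewrite muln_gt0 !expn_gt0 k0 Q0.
rewrite -(leq_pmul2l P0).
have -> : k ^ k * Q ^ (b * k) * (X * 2 ^ k) = (k ^ k * 2 ^ k) * (X * Q ^ (b * k)) by lia.
apply: leq_trans (leq_mul (leqnn _) hX) _.
have -> : k ^ k * 2 ^ k * ('C(F, k) * (m ^ (b * k) * O)) =
  ('C(F, k) * k ^ k) * (2 ^ k * m ^ (b * k) * O) by lia.
apply: leq_trans (leq_mul (bin_exp_le F k) (leqnn _)) _.
rewrite !mulnA leq_mul2r !expnM -!expnMn; apply/orP; right.
case: k k0 {hX P0} hF => // k _ hF; rewrite leq_exp2r //; lia.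
Qed.

(** For rare events, whose expected number is at most 2^(-h), the cruder F^k already gives 2^(-h
    k). *)
Lemma first_moment_exp (F k b h m Q O X : nat) :
  2 ^ h * F * m ^ b <= Q ^ b -> X * Q ^ (b * k) <= 'C(F, k) * (m ^ (b * k) * O) ->
  0 < Q -> X * 2 ^ (h * k) <= O.
Proof.
move=> hF hX Q0.
have P0 : 0 < Q ^ (b * k) by rewrite expn_gt0 Q0.
rewrite -(leq_pmul2l P0).
have -> : Q ^ (b * k) * (X * 2 ^ (h * k)) = 2 ^ (h * k) * (X * Q ^ (b * k)) by lia.
apply: leq_trans (leq_mul (leqnn _) hX) _.
rewrite !mulnA leq_mul2r; apply/orP; right.
apply: (@leq_trans (2 ^ (h * k) * F ^ k * m ^ (b * k))).
  by rewrite leq_mul2r leq_mul2l bin_le_exp !orbT.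
rewrite !expnM -!expnMn; case: k {hX P0} => // k; by rewrite leq_exp2r.
Qed.

Lemma six_eighths a1 a2 a3 a4 a5 a6 O : 0 < O -> a1 * 8 <= O -> a2 * 8 <= O ->
  a3 * 8 <= O -> a4 * 8 <= O -> a5 * 8 <= O -> a6 * 8 <= O ->
  a1 + (a2 + (a3 + (a4 + (a5 + (a6 + 0))))) < O.
Proof. lia. Qed.

Lemma card_exists_eighth (W D : finType) (F : {set D}) (P : D -> pred W) (e O : nat) :
  (forall a, a \in F -> #|[set w | P a w]| * 2 ^ e <= O) -> #|F| * 8 <= 2 ^ e ->
  #|[set w | [exists a in F, P a w]]| * 8 <= O.
Proof.
move=> /card_exists_le_cst h hF; have e0 : 0 < 2 ^ e by rewrite expn_gt0.
rewrite -(leq_pmul2r e0) mulnAC; apply: leq_trans (leq_mul h (leqnn 8)) _.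
by rewrite mulnAC [X in _ <= X]mulnC leq_mul2r hF orbT.
Qed.

(** Greedy choice: removing [b] elements from one fibre lowers its quotient by exactly one. *)
Lemma column_family (I V : finType) (pr : I -> V) (b v : nat) (O : {set I}) : 0 < b ->
  v <= \sum_x #|[set p in O | pr p == x]| %/ b ->
  exists S : {set {set I}}, [/\ #|S| = v, trivIset S &
    forall A, A \in S -> [/\ #|A| = b, A \subset O & exists x, forall p, p \in A -> pr p = x]].
Proof.
move=> b0; elim: v O => [|v IH] O hv.
  exists set0; rewrite cards0; split=> //; first by apply/trivIsetP => A B; rewrite inE.
  by move=> A; rewrite inE.
have [x hx] : exists x, b <= #|[set p in O | pr p == x]|.
  apply/existsP; apply: contraLR hv => /existsPn none.
  rewrite big1 // => x _; apply: divn_small; by rewrite ltnNge.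
have [A AO cA] := subset_card_exists hx.
have AO' : A \subset O by apply: subset_trans AO _; apply/subsetP => p; rewrite inE => /andP[].
have Ax p : p \in A -> pr p = x by move/(subsetP AO); rewrite inE => /andP[_ /eqP].
have [|S [cS tS HS]] := IH (O :\: A).
  rewrite -ltnS; apply: leq_trans hv _; rewrite (bigD1 x) //= [X in _ <= X.+1](bigD1 x) //=.
  rewrite -addSn; apply: leq_add.
    have -> : [set p in O :\: A | pr p == x] = [set p in O | pr p == x] :\: A.
      by apply/setP => p; rewrite !inE andbA.
    have := cardsID A [set p in O | pr p == x]; rewrite (setIidPr AO) cA => <-.
    by rewrite divnDl // divnn b0 add1n.
  apply: leq_sum => x' nx; apply: leq_div2r; apply: subset_leq_card; apply/subsetP => p.
  rewrite !inE => /andP[-> px]; rewrite px !andbT; apply/negP => /Ax px'.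
  by rewrite -px' (eqP px) eqxx in nx.
have dis B : B \in S -> [disjoint A & B].
  move/HS => [_ BO _]; rewrite disjoint_sym disjoint_subset; apply/subsetP => p /(subsetP BO).
  by rewrite !inE => /andP[].
have S0 : set0 \notin S by apply/negP => /HS[]; rewrite cards0 => b0'; rewrite -b0' in b0.
have [tS' AS] := trivIsetU1 dis tS S0.
exists (A |: S); split=> //; first by rewrite cardsU1 AS cS.
move=> B; rewrite !inE => /predU1P[->|/HS[cB BO HB]]; first by split=> //; exists x.
by split=> //; apply: subset_trans BO (subsetDl _ _).
Qed.

Section Probability.
Variables (B V K : finType) (Q m : nat) (col : B -> K).
Hypotheses (mQ : m <= Q) (m_gt0 : 0 < m).
Variables (s d y t M N h : nat) (v : nat -> nat).
Local Notation Omega := {ffun B * V -> 'I_Q}.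
Hypothesis colN : forall i, #|color_blocks col i| = N.

Let Q_gt0 : 0 < Q. Proof. exact: leq_trans mQ. Qed.
Let cO : #|{: Omega}| = Q ^ #|{: B * V}|. Proof. by rewrite card_ffun card_ord. Qed.

Definition many_on (A : {set B * V}) (k : nat) (w : Omega) :=
  k <= #|[set p in A | w p < m]|.

Lemma card_many_on_le (A : {set B * V}) k : 0 < k -> 8 * #|A| * m <= k * Q ->
  #|[set w | many_on A k w]| * 2 ^ k <= #|{: Omega}|.
Proof.
move=> k0 hA; apply: (@first_moment #|A| k 1 m Q) => //.
by rewrite mul1n cO; apply: card_many_on.
Qed.

Definition large_block_outcomes : {set Omega} :=
  [set w | [exists j in [set: B], many_on (setX [set j] setT) s w]].

Lemma card_large_block : 0 < s -> 8 * #|V| * m <= s * Q -> #|B| * 8 <= 2 ^ s ->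
  #|large_block_outcomes| * 8 <= #|{: Omega}|.
Proof.
move=> s0 hs hB; apply: (@card_exists_eighth _ _ _ _ s); last by rewrite cardsT.
by move=> j _; apply: card_many_on_le; rewrite // cardsX cards1 mul1n cardsT.
Qed.

Lemma small_blocksP w : w \notin large_block_outcomes -> small_blocks m w s.
Proof.
move=> hw j; rewrite leqNgt; apply: contra hw => lt; rewrite inE; apply/existsP; exists j.
rewrite inE /many_on; apply: leq_trans (ltnW lt) _.
have inj : injective (fun x : V => (j, x)) by move=> x x' [].
rewrite -(card_imset _ inj).
by apply: subset_leq_card; apply/subsetP => p /imsetP[x]; rewrite inE => hx ->; rewrite !inE eqxx.
Qed.

Definition large_degree_outcomes : {set Omega} :=
  [set w | [exists u in [set: K * V], many_on (setX (color_blocks col u.1) [set u.2]) d w]].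

Lemma card_large_degree : 0 < d -> 8 * N * m <= d * Q -> #|K| * #|V| * 8 <= 2 ^ d ->
  #|large_degree_outcomes| * 8 <= #|{: Omega}|.
Proof.
move=> d0 hd hK; apply: (@card_exists_eighth _ _ _ _ d); last by rewrite cardsT card_prod.
by move=> u _; apply: card_many_on_le; rewrite // cardsX cards1 muln1 colN.
Qed.

Lemma small_degreesP w : w \notin large_degree_outcomes -> small_degrees m col w d.
Proof.
move=> hw i x; rewrite leqNgt; apply: contra hw => lt; rewrite inE; apply/existsP; exists (i, x).
rewrite inE /many_on; apply: leq_trans (ltnW lt) _.
have inj : injective (fun j : B => (j, x)) by move=> j j' [].
  rewrite -(card_imset _ inj).
apply: subset_leq_card; apply/subsetP => p /imsetP[j]; rewrite !inE => /andP[cj hj] ->.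
by rewrite /= eqxx cj.
Qed.

Definition dense_incidence_outcomes : {set Omega} :=
  [set w | [exists u in [set u : {set V} * {set B} | (#|u.1| == t) && (#|u.2| == t)],
     many_on (setX u.2 u.1) (y * t) w]].

Lemma card_dense_incidence : 0 < y * t -> 8 * t * m <= y * Q ->
  #|V| ^ t * #|B| ^ t * 8 <= 2 ^ (y * t) ->
  #|dense_incidence_outcomes| * 8 <= #|{: Omega}|.
Proof.
move=> yt0 hy hV; apply: (@card_exists_eighth _ _ _ _ (y * t)).
  move=> u; rewrite inE => /andP[/eqP u1 /eqP u2]; apply: card_many_on_le => //.
  rewrite cardsX u1 u2; have := leq_mul hy (leqnn t); lia.
apply: leq_trans hV; rewrite leq_mul2r; apply/orP; right.
rewrite -!cardsT; apply: leq_trans (_ : _ <= _) (leq_mul (bin_le_exp _ _) (bin_le_exp _ _)).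
rewrite -!cards_draws -cardsX; apply: subset_leq_card; apply/subsetP => -[X T].
by rewrite !inE /= !subsetT.
Qed.

Lemma sparse_incidencesP w : w \notin dense_incidence_outcomes -> sparse_incidences m w y t.
Proof.
move=> hw X T Xt Tt; rewrite ltnNge; apply: contra hw => le; rewrite inE.
by apply/existsP; exists (X, T); rewrite inE Xt Tt !eqxx.
Qed.

Definition dense_meeting_outcomes b : {set Omega} :=
  [set w | [exists u in [set u : K * {set B} | (u.2 \subset color_blocks col u.1) && (#|u.2| == 2 * M)],
     v b <= \sum_x #|[set j in u.2 | in_block m w j x]| %/ b]].

Definition columns (U : {set B}) b : {set {set B * V}} :=
  [set A : {set B * V} | (#|A| == b) && [exists x, A \subset setX U [set x]]].

Lemma card_columns (U : {set B}) b : #|columns U b| <= #|V| * #|U| ^ b.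
Proof.
apply: (@leq_trans #|\bigcup_(x in V) [set A : {set B * V} | (A \subset setX U [set x]) && (#|A| == b)]|).
  apply: subset_leq_card; apply/subsetP => A; rewrite inE => /andP[cA /existsP[x Ax]].
  by apply/bigcupP; exists x => //; rewrite inE Ax cA.
apply: leq_trans (leq_card_bigcup _ _) _; rewrite -sum_nat_const; apply: leq_sum => x _.
by rewrite cards_draws cardsX cards1 muln1 bin_le_exp.
Qed.

Lemma card_dense_meeting_event (U : {set B}) b : 0 < b ->
  #|[set w : Omega | v b <= \sum_x #|[set j in U | in_block m w j x]| %/ b]| * Q ^ (b * v b) <=
  'C(#|columns U b|, v b) * (m ^ (b * v b) * #|{: Omega}|).
Proof.
move=> b0; rewrite cO.
have cb A : A \in columns U b -> #|A| = b by rewrite inE => /andP[/eqP].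
apply: leq_trans (card_disjoint_on mQ (v b) cb).
rewrite leq_mul2r; apply/orP; right; apply: subset_leq_card; apply/subsetP => w.
rewrite !inE => hv.
pose O : {set B * V} := [set p in setX U setT | w p < m].
have [|S [cS tS HS]] := @column_family _ _ (@snd B V) b (v b) O b0.
  apply: leq_trans hv _; apply: leq_sum => x _; apply: leq_div2r.
  have inj : injective (fun j : B => (j, x)) by move=> j j' [].
  rewrite -(card_imset _ inj).
  apply: subset_leq_card; apply/subsetP => p /imsetP[j]; rewrite inE => /andP[cj hj] ->.
  by rewrite !inE /= eqxx cj !andbT; exact: hj.
apply/existsP; exists S; rewrite cS eqxx tS /=; apply/andP; split.
  apply/subsetP => A /HS[cA AO [x Ax]]; rewrite inE cA eqxx; apply/existsP; exists x.
  apply/subsetP => p pA; rewrite !inE (Ax p pA) eqxx andbT.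
  by have := subsetP AO p pA; rewrite !inE andbT => /andP[].
apply/forall_inP => A /HS[_ AO _]; apply/forall_inP => p /(subsetP AO).
by rewrite inE => /andP[].
Qed.

Lemma card_dense_meeting_index :
  #|[set u : K * {set B} | (u.2 \subset color_blocks col u.1) && (#|u.2| == 2 * M)]|
  <= #|K| * N ^ (2 * M).
Proof.
apply: (@leq_trans (\sum_(i : K) 'C(N, 2 * M))); last first.
  by rewrite -sum_nat_const; apply: leq_sum => i _; apply: bin_le_exp.
rewrite -sum1_card (eq_bigr (fun i => \sum_(U : {set B} | (U \subset color_blocks col i) && (#|U| == 2 * M)) 1)).
  by rewrite pair_big_dep /= leq_eqVlt; apply/orP; left; apply/eqP/eq_bigl => -[i U]; rewrite inE.
by move=> i _; rewrite sum1dep_card -(colN i) cards_draws.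
Qed.

Lemma card_dense_meeting2 : 0 < v 2 -> 8 * (#|V| * (2 * M) ^ 2) * m ^ 2 <= v 2 * Q ^ 2 ->
  #|K| * N ^ (2 * M) * 8 <= 2 ^ v 2 ->
  #|dense_meeting_outcomes 2| * 8 <= #|{: Omega}|.
Proof.
move=> v0 hv hK; apply: (@card_exists_eighth _ _ _ _ (v 2)); last first.
  by apply: leq_trans hK; rewrite leq_mul2r card_dense_meeting_index orbT.
move=> [i U]; rewrite inE /= => /andP[_ /eqP cU].
apply: (@first_moment #|columns U 2| (v 2) 2 m Q) => //; last exact: card_dense_meeting_event.
by apply: leq_trans hv; rewrite leq_mul2r leq_mul2l -cU card_columns !orbT.
Qed.

(** Three blocks of [U] through one vertex are so rare that each triple gains a factor 2^(-h); a
    smaller [v 3] then survives the union bound over [U]. *)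
Lemma card_dense_meeting3 : 2 ^ h * (#|V| * (2 * M) ^ 3) * m ^ 3 <= Q ^ 3 ->
  #|K| * N ^ (2 * M) * 8 <= 2 ^ (h * v 3) ->
  #|dense_meeting_outcomes 3| * 8 <= #|{: Omega}|.
Proof.
move=> hv hK; apply: (@card_exists_eighth _ _ _ _ (h * v 3)); last first.
  by apply: leq_trans hK; rewrite leq_mul2r card_dense_meeting_index orbT.
move=> [i U]; rewrite inE /= => /andP[_ /eqP cU].
apply: (@first_moment_exp #|columns U 3| (v 3) 3 h m Q) => //; last exact: card_dense_meeting_event.
by apply: leq_trans hv; rewrite leq_mul2r leq_mul2l -cU card_columns !orbT.
Qed.

Lemma sparse_meetingsP w b : w \notin dense_meeting_outcomes b -> sparse_meetings m col w M v b.
Proof.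
move=> hw i U UB cU; rewrite ltnNge; apply: contra hw => le; rewrite inE.
by apply/existsP; exists (i, U); rewrite inE /= UB cU eqxx.
Qed.

(** The guard on the number of bad pairs depends on earlier blocks only and makes the failure
    probability at most 1/2 for every past. *)
Definition failing_outcomes (rk : B -> nat) : {set Omega} :=
  [set w | [exists u in [set u : K * {set V} | #|u.2| == t],
     [forall j in color_blocks col u.1,
       (#|bad_pairs m col rk w u.2 j| * (4 * m ^ 2) <= Q ^ 2) &&
       block_fail m col rk w u.2 j]]].

Lemma card_failing (rk : B -> nat) : injective rk -> 4 * m * Q.-1 ^ t <= Q ^ t ->
  #|K| * #|V| ^ t * 8 <= 2 ^ N -> #|failing_outcomes rk| * 8 <= #|{: Omega}|.
Proof.
move=> rk_inj hQ hN; apply: (@card_exists_eighth _ _ _ _ N).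
  move=> [i X]; rewrite inE /= => /eqP Xt; rewrite -(colN i).
  pose cond (w : Omega) j := #|bad_pairs m col rk w X j| * (4 * m ^ 2) <= Q ^ 2.
  apply: (@sequential_fail B V Q Q_gt0 rk rk_inj cond (fun w j => block_fail m col rk w X j)).
  - by move=> j w w' ww'; rewrite /cond (bad_pairs_past m col X ww').
  - by move=> j w w' ww'; apply: block_fail_past.
  - by move=> w j hw; apply: card_block_fail; rewrite ?Xt.
apply: leq_trans hN; rewrite leq_mul2r; apply/orP; right.
rewrite -[#|V|]cardsT; apply: leq_trans (_ : _ <= _) (leq_mul (leqnn #|K|) (bin_le_exp _ _)).
rewrite -!cards_draws -cardsT -cardsX; apply: subset_leq_card; apply/subsetP => -[i X].
by rewrite !inE /= !subsetT.
Qed.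

Lemma pattern_exists (rk : B -> nat) : injective rk ->
  0 < s -> 8 * #|V| * m <= s * Q -> #|B| * 8 <= 2 ^ s ->
  0 < d -> 8 * N * m <= d * Q -> #|K| * #|V| * 8 <= 2 ^ d ->
  0 < y * t -> 8 * t * m <= y * Q -> #|V| ^ t * #|B| ^ t * 8 <= 2 ^ (y * t) ->
  0 < v 2 -> 8 * (#|V| * (2 * M) ^ 2) * m ^ 2 <= v 2 * Q ^ 2 ->
  #|K| * N ^ (2 * M) * 8 <= 2 ^ v 2 ->
  2 ^ h * (#|V| * (2 * M) ^ 3) * m ^ 3 <= Q ^ 3 ->
  #|K| * N ^ (2 * M) * 8 <= 2 ^ (h * v 3) ->
  4 * m * Q.-1 ^ t <= Q ^ t -> #|K| * #|V| ^ t * 8 <= 2 ^ N ->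
  t * d <= s * M -> 2 * M <= N -> t <= #|B| ->
  (t * d * s + (y * (#|K| * (t * d)) + s * (y * t)) + s ^ 2 * (2 * v 2 + 5 * d * v 3))
     * (4 * m ^ 2) <= Q ^ 2 ->
  exists w : Omega, forall (X : {set V}) i, #|X| = t ->
    exists g : 'I_m -> V, clique_map (pattern_edges m col rk w i) g /\ forall a, g a \in X.
Proof.
move=> rk_inj s0 s1 s2 d0 d1 d2 y0 y1 y2 v0 v1 v2 h1 h2 f1 f2 sM NM tB hbad.
pose bad := [:: large_block_outcomes; large_degree_outcomes; dense_incidence_outcomes;
  dense_meeting_outcomes 2; dense_meeting_outcomes 3; failing_outcomes rk].
have [w hw] : exists w, forall S, S \in bad -> w \notin S.
  have c1 := card_large_block s0 s1 s2.
  have c2 := card_large_degree d0 d1 d2.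
  have c3 := card_dense_incidence y0 y1 y2.
  have c4 := card_dense_meeting2 v0 v1 v2.
  have c5 := card_dense_meeting3 h1 h2.
  have c6 := card_failing rk_inj f1 f2.
  have O0 : 0 < #|{: Omega}| by rewrite cO expn_gt0 Q_gt0.
  have : #|\bigcup_(S <- bad) S| < #|{: Omega}|.
    apply: (@leq_ltn_trans (\sum_(S <- bad) #|S|)).
      elim/big_rec2: _ => [|S n A _ IH]; first by rewrite cards0.
      by rewrite (leq_trans (leq_card_setU _ _)) // leq_add2l.
    rewrite !big_cons big_nil.
    exact: six_eighths.
  rewrite -cardsT => lt.
  have /subsetPn[w _ hw] : ~~ ([set: Omega] \subset \bigcup_(S <- bad) S).
    by apply: contraL lt => /subset_leq_card; rewrite -leqNgt.
  exists w => S Sbad; apply: contra hw => wS; by rewrite (big_rem _ Sbad) /= inE wS.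
exists w => X i Xt.
have G k : k < 6 -> w \notin nth set0 bad k by move=> k6; apply/hw/mem_nth.
(* Outside [failing_outcomes] some block of colour [i] succeeds or has too many bad pairs; the other
   five properties exclude the latter. *)
have [j ji nf] : exists2 j, j \in color_blocks col i & ~~ block_fail m col rk w X j.
  have := G 5 isT; rewrite /= inE => /existsPn/(_ (i, X)); rewrite inE /= Xt eqxx /=.
  case/forall_inPn => j ji; rewrite negb_and => hj; exists j => //.
  case/orP: hj => // /negP[].
  apply: leq_trans (leq_mul _ (leqnn _)) hbad.
  apply: (@card_bad_pairs _ _ _ _ _ _ _ _ s d y t M v) => //.
  - exact: small_blocksP (G 0 isT).
  - exact: small_degreesP (G 1 isT).
  - exact: sparse_incidencesP (G 2 isT).
  - exact: sparse_meetingsP (G 3 isT).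
  - exact: sparse_meetingsP (G 4 isT).
  - by move=> i'; rewrite colN.
have [g [gcl gX]] := block_clique nf; exists g; split=> //.
by move: ji gcl; rewrite inE => /eqP->.
Qed.

End Probability.

(** * The choice of the parameters *)

(** From l <= b 2^(l/b) follows l^b <= b^b 2^l, and [5 < b] leaves a spare factor [l] to absorb
    [A * b ^ b]. *)
Lemma poly_le_exp2 (A b l : nat) : 5 < b -> A * b ^ b <= l -> A * l ^ 5 <= 2 ^ l.
Proof.
move=> b5 hA; have b0 : 0 < b by apply: leq_trans b5.
have c0 : 0 < b ^ b by rewrite expn_gt0 b0.
rewrite -(leq_pmul2r c0) mulnAC.
case: (posnP l) => [->|l0]; first by rewrite exp0n // muln0.
apply: (@leq_trans (l ^ b)).
  apply: (@leq_trans (l ^ 6)); last by rewrite leq_pexp2l.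
  by rewrite [l ^ 6]expnS leq_mul2r hA orbT.
have hl : l <= b * 2 ^ (l %/ b).
  apply: (@leq_trans (b * (l %/ b).+1)); first by rewrite mulnC ltnW // ltn_ceil.
  by rewrite leq_mul2l ltn_expl ?orbT.
apply: (@leq_trans ((b * 2 ^ (l %/ b)) ^ b)); first by rewrite leq_exp2r.
by rewrite expnMn mulnC leq_mul2r -expnM leq_pexp2l ?orbT // leq_divM.
Qed.

(** The first two terms of the binomial expansion suffice. In other words, (1 - 1/Q)^Q <= 1/2. *)
Lemma double_pred_exp q : 2 * q ^ q.+1 <= q.+1 ^ q.+1.
Proof.
have h k : q ^ k.+1 + k.+1 * q ^ k <= q.+1 ^ k.+1.
  elim: k => [|k IH]; first by rewrite !expn1 expn0 mul1n addn1.
  apply: leq_trans (_ : q.+1 * (q ^ k.+1 + k.+1 * q ^ k) <= _); last first.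
    by rewrite [X in _ <= X]expnS leq_mul2l IH.
  rewrite 2!expnS; set a := q ^ k; nia.
apply: leq_trans (h q); rewrite mul2n -addnn leq_add2l [X in _ <= X]mulSn -expnS.
exact: leq_addl.
Qed.

(** Each [Q] factors halve the product, and 4 m <= 2^(m+3); hence [t] is taken to be
    [(m + 3) * Q]. *)
Lemma missing_label_bound m Q : 0 < Q -> 4 * m * Q.-1 ^ ((m + 3) * Q) <= Q ^ ((m + 3) * Q).
Proof.
case: Q => // q _; rewrite [_ * q.+1]mulnC !expnM.
apply: leq_trans (_ : (2 * q ^ q.+1) ^ (m + 3) <= _); last first.
  by rewrite leq_exp2r ?double_pred_exp // addn3.
rewrite expnMn leq_mul2r; apply/orP; right; rewrite expnD.
have : m < 2 ^ m by apply: ltn_expl.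
rewrite -[2 ^ 3]/8; lia.
Qed.

(* Blocks have expected size [e * r], a vertex lies in [6 * e * l] blocks of each
   colour on average, and the bounds on sizes and degrees are 8 times that. *)
Lemma folkman_pattern_num (m c e C l r Q t : nat) : 1 < m -> c = m + 3 -> e = m * c ->
  C = 4 * m ^ 2 * (384 * c * e ^ 2 + 672 * c * e
        + 64 * e ^ 2 * c * (2304 * e ^ 2 + 240 * 74 * e)) ->
  r = 4 ^ l -> Q = C * r * l ^ 2 -> t = c * Q ->
  e <= l -> 1728 * c ^ 4 * m ^ 3 * C * l ^ 5 <= 2 ^ l ->
  exists E : 'I_r -> rel 'I_(r * t), kfree_coloring m.+1 E /\
    forall X : {set 'I_(r * t)}, #|X| = t -> forall i,
    exists g : 'I_m -> 'I_(r * t), clique_map (E i) g /\ forall a, g a \in X.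
Proof.
move=> m_gt1 cE eE CE r4 QE tE el Al.
have c3 : 3 < c by rewrite cE -[3]add0n ltn_add2r ltnW.
have c_gt0 : 0 < c by apply: ltn_trans c3.
have m0 := ltnW m_gt1.
have e_gt0 : 0 < e by rewrite eE muln_gt0 m0.
have l_gt0 : 0 < l by apply: leq_trans el.
have rE : r = 2 ^ (2 * l) by rewrite r4 (expnM 2 2).
have l2 : l < 2 ^ l by apply: ltn_expl.
have r_gt0 : 0 < r by rewrite rE ?expn_gt0.
have lr : 2 * l < r by rewrite rE ltn_expl.
have [k kE] : exists k, k = 384 * c * e ^ 2 + 672 * c * e
   + 64 * e ^ 2 * c * (2304 * e ^ 2 + 240 * 74 * e) by eexists.
have k0 : 0 < k.
  rewrite kE -addnA; apply: ltn_addr; rewrite muln_gt0 ?expn_gt0 e_gt0 andbT.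
  by rewrite muln_gt0 c_gt0.
rewrite -kE in CE.
have C_gt0 : 0 < C by rewrite CE muln_gt0 k0 andbT muln_gt0 ?expn_gt0 m0.
have Q_gt0 : 0 < Q by rewrite QE !muln_gt0 C_gt0 r_gt0 ?expn_gt0 l_gt0.
(* The union bound over colours and sets [X] requires 8 r (r t)^t <= 2^N, where r t <= 2^(5 l). *)
have [N NE] : exists N, N = 6 * l * t by eexists.
have tN : t <= N by rewrite NE leq_pmull // muln_gt0 l_gt0.
have rrE : r * r = 2 ^ (4 * l) by rewrite rE -expnD; congr (2 ^ _); clear; lia.
have hJ : r * N <= 2 ^ (5 * l).
  have -> : r * N = (r * r) * (6 * (c * C * l ^ 3)) by rewrite NE tE QE; clear; lia.
  rewrite rrE (_ : 5 * l = 4 * l + l); last by clear; lia.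
  rewrite expnD leq_mul2l; apply/orP; right; apply: leq_trans Al.
  have -> : 1728 * c ^ 4 * m ^ 3 * C * l ^ 5 = 1728 * (c ^ 3 * m ^ 3 * l ^ 2) * (c * C * l ^ 3) by clear; lia.
  rewrite leq_mul2r; apply/orP; right.
  have : 0 < c ^ 3 * m ^ 3 * l ^ 2 by rewrite !muln_gt0 ?expn_gt0 m0 l_gt0 c_gt0.
  by move: (_ * l ^ 2) => u; clear; lia.
have hn : r * t <= 2 ^ (5 * l) by apply: leq_trans hJ; rewrite leq_mul2l tN orbT.
have hN : N <= 2 ^ (5 * l) by apply: leq_trans hJ; rewrite leq_pmull.
have mQ : m <= Q.
  apply: (@leq_trans C); last first.
    by rewrite QE -mulnA leq_pmulr // muln_gt0 r_gt0 ?expn_gt0 l_gt0.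
  rewrite CE (_ : 4 * m ^ 2 * k = m * (4 * m * k)); last by clear; lia.
  by rewrite leq_pmulr // !muln_gt0 m0.
(* With [s] and [d] below, this makes t d = s M. *)
have [M ME] : exists M, M = 6 * c * C * l ^ 3 by eexists.
(* This is 8 times the bound on the expected number of pairs of blocks of [U] through a common
   vertex. *)
have [v2 v2E] : exists v2, v2 = 1152 * e ^ 2 * c * C * l ^ 4 by eexists.
(* The product l v3 has to exceed the exponent 60 c C l^4 + 2 l + 3 from the union bound over
   [U]. *)
have [v3 v3E] : exists v3, v3 = 74 * c * C * l ^ 3 by eexists.
have [s sE] : exists s, s = 8 * e * r by eexists.
have [d dE] : exists d, d = 48 * e * l by eexists.
have cC0 : 0 < c * C by rewrite muln_gt0 C_gt0 c_gt0.
have l4 : l <= c * C * l ^ 4.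
  by rewrite expnS mulnCA leq_pmulr // muln_gt0 cC0 ?expn_gt0 l_gt0.
have M0 : 0 < M by rewrite ME -mulnA !muln_gt0 c_gt0 C_gt0 ?expn_gt0 l_gt0.
have NM : r * N ^ (2 * M) * 8 <= 2 ^ (2 * l + 5 * l * (2 * M) + 3).
  rewrite (expnD 2 (2 * l + _)) (expnD 2 (2 * l)).
  apply: leq_mul => //; rewrite rE leq_mul2l [2 ^ (5 * l * _)]expnM.
  by apply/orP; right; rewrite leq_exp2r // muln_gt0 M0.
have l3 : 2 * l + 3 <= 5 * l by move: l_gt0; clear; lia.
have tl : 4 < t.
  apply: (@leq_trans c); last by rewrite tE leq_pmulr.
  by rewrite cE -[5]/(2 + 3) leq_add2r.
have cJ : #|{: 'I_r * 'I_N}| = r * N by rewrite card_prod !card_ord.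
have colN (i : 'I_r) : #|color_blocks fst i : {set 'I_r * 'I_N}| = N.
  have inj : injective (fun j : 'I_N => (i, j)) by move=> j j' [].
  rewrite -[RHS]card_ord -cardsT -(card_imset _ inj); apply: eq_card => -[i' j].
  rewrite inE /=; apply/eqP/imsetP => [->|[j' _ [->]] //]; by exists j.
have rkinj : injective (fun u : 'I_r * 'I_N => enum_rank u : nat).
  by move=> u u' /ord_inj/enum_rank_inj.
pose v b := if b == 2 then v2 else v3.
(* Here [y] is [12 * l], as the sets of [t] vertices and [t] blocks cost an exponent 10 l t + 3, and
   [h] is [l]. *)
have [] := @pattern_exists ('I_r * 'I_N)%type 'I_(r * t) 'I_r Q m
   fst mQ m0 s d (12 * l) t M N l v colN _ rkinj.
- by rewrite sE muln_gt0 r_gt0 muln_gt0 e_gt0.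
- by rewrite card_ord sE tE eE; clear; lia.
- rewrite cJ; apply: (@leq_trans (2 ^ (5 * l + 3))); first by rewrite (expnD 2 (5 * l)) leq_mul.
  rewrite leq_exp2l // sE; apply: (@leq_trans (4 * r)).
    by move: lr r_gt0; clear; lia.
  by rewrite leq_mul2r; move: e_gt0; clear; lia.
- by rewrite dE !muln_gt0 e_gt0 l_gt0.
- by rewrite NE dE tE eE; clear; lia.
- rewrite !card_ord dE; apply: (@leq_trans (2 ^ (2 * l + 5 * l + 3))).
    rewrite (expnD 2 (2 * l + _)) (expnD 2 (2 * l)) -rE; apply: leq_mul => //.
    by rewrite leq_mul2l hn orbT.
  rewrite leq_exp2l //; apply: (@leq_trans (48 * 1 * l)); first by move: l3; clear; lia.
  by rewrite !leq_mul2r leq_mul2l e_gt0 !orbT.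
- by rewrite !muln_gt0 l_gt0 (ltn_trans _ tl).
- rewrite tE mulnA mulnAC leq_mul2r; apply/orP; right.
  move: el; rewrite eE; clear; lia.
- rewrite card_ord cJ; apply: (@leq_trans (2 ^ (5 * l * t + 5 * l * t + 3))).
    rewrite (expnD 2 (5 * l * t + _)) (expnD 2 (5 * l * t)).
    apply: leq_mul => //; rewrite ![2 ^ (5 * l * t)]expnM.
    by apply: leq_mul; rewrite leq_exp2r // (ltn_trans _ tl).
  by rewrite leq_exp2l //; move: tl l_gt0; clear; nia.
- by rewrite /v /= v2E !muln_gt0 ?expn_gt0 e_gt0 c_gt0 C_gt0 l_gt0.
- by rewrite card_ord /v /= v2E ME tE QE eE; clear; lia.
- rewrite card_ord; apply: leq_trans NM _; rewrite /v /= leq_exp2l // v2E ME.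
  have : 0 < e ^ 2 by rewrite expn_gt0 e_gt0.
  have -> : 5 * l * (2 * (6 * c * C * l ^ 3)) = 60 * (c * C * l ^ 4) by clear; lia.
  have -> : 1152 * e ^ 2 * c * C * l ^ 4 = 1152 * (e ^ 2 * (c * C * l ^ 4)) by clear; lia.
  move: l4 l3; clear; move: (e ^ 2) => u; move: (c * C * l ^ 4) => x lx l3 u0.
  have : x <= u * x by rewrite leq_pmull.
  by move: lx l3; clear; move: (u * x) => ux; lia.
(* One factor 2^l of r = 2^l 2^l pays for [2 ^ h], the other for the polynomial in [l]. *)
- rewrite card_ord ME tE.
  have -> : 2 ^ l * (r * (c * Q) * (2 * (6 * c * C * l ^ 3)) ^ 3) * m ^ 3 =
     (2 ^ l * (1728 * c ^ 4 * m ^ 3 * C * l ^ 5)) * (r * Q * C ^ 2 * l ^ 4) by clear; lia.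
  have -> : Q ^ 3 = r * (r * Q * C ^ 2 * l ^ 4) by rewrite expnS mulnC {1}QE; clear; lia.
  by rewrite leq_mul2r rE mul2n -addnn (expnD 2 l l) leq_mul2l Al !orbT.
- rewrite card_ord; apply: leq_trans NM _; rewrite /v /= leq_exp2l // v3E ME.
  have -> : 5 * l * (2 * (6 * c * C * l ^ 3)) = 60 * (c * C * l ^ 4) by clear; lia.
  have -> : l * (74 * c * C * l ^ 3) = 74 * (c * C * l ^ 4) by clear; lia.
  by move: l4 l3; clear; move: (c * C * l ^ 4) => x; lia.
- by rewrite tE cE; apply: missing_label_bound.
- rewrite !card_ord; apply: (@leq_trans (2 ^ (2 * l + 5 * l * t + 3))).
    rewrite (expnD 2 (2 * l + _)) (expnD 2 (2 * l)) -rE; apply: leq_mul => //.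
    rewrite leq_mul2l expnM; apply/orP; right.
    by rewrite leq_exp2r // (ltn_trans _ tl).
  by rewrite leq_exp2l // NE; move: tl l_gt0 l3; clear; nia.
- by rewrite tE dE sE ME QE; clear; lia.
- rewrite ME NE tE QE.
  have -> : 2 * (6 * c * C * l ^ 3) = 6 * c * C * l ^ 3 * 2 by clear; lia.
  have -> : 6 * l * (c * (C * r * l ^ 2)) = 6 * c * C * l ^ 3 * r by clear; lia.
  by rewrite leq_mul2l orbC; apply/orP; left; move: lr l_gt0; clear; lia.
- by rewrite cJ; apply: leq_trans tN _; rewrite leq_pmull.
(* Each term is a constant times Q r l or Q r l^2, and the constants add up to [k]; the factor 4 m^2
   k in [C] makes Q^2 large enough. *)
- rewrite card_ord /v /= v2E v3E tE dE sE.
  have -> : Q ^ 2 = Q * r * l ^ 2 * k * (4 * m ^ 2) by rewrite -mulnn {2}QE CE; clear; lia.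
  rewrite leq_mul2r; apply/orP; right; rewrite kE.
  have ll : Q * r * l <= Q * r * l ^ 2 by rewrite leq_mul2l -mulnn leq_pmull ?orbT.
  apply: (@leq_trans ((384 * c * e ^ 2 + 96 * c * e) * (Q * r * l) +
     (576 * c * e + 64 * e ^ 2 * c * (2304 * e ^ 2 + 240 * 74 * e)) * (Q * r * l ^ 2))).
    by rewrite leq_eqVlt; apply/orP; left; apply/eqP; rewrite QE; clear; lia.
  apply: leq_trans (leq_add (leq_mul (leqnn _) ll) (leqnn _)) _.
  by rewrite -mulnDl [X in _ <= X]mulnC leq_mul2r; clear; lia.
move=> w Hw; exists (pattern_edges m fst (fun u => enum_rank u : nat) w); split.
  exact: pattern_free.
by move=> X Xt i; apply: Hw.
Qed.

Lemma folkman_pattern (m : nat) : 1 < m -> exists A l0, forall l, l0 <= l ->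
  exists t (E : 'I_(4 ^ l) -> rel 'I_(4 ^ l * t)),
  [/\ 4 ^ l * t = A * (4 ^ l * l) ^ 2, kfree_coloring m.+1 E &
    forall X : {set 'I_(4 ^ l * t)}, #|X| = t -> forall i,
    exists g : 'I_m -> 'I_(4 ^ l * t), clique_map (E i) g /\ forall a, g a \in X].
Proof.
move=> m_gt1.
have [c cE] : exists c, c = m + 3 by eexists.
have [e eE] : exists e, e = m * c by eexists.
have [C CE] : exists C, C = 4 * m ^ 2 * (384 * c * e ^ 2 + 672 * c * e
        + 64 * e ^ 2 * c * (2304 * e ^ 2 + 240 * 74 * e)) by eexists.
have [b b5] : exists b, 5 < b by exists 6.
exists (c * C), (e + 1728 * c ^ 4 * m ^ 3 * C * b ^ b) => l l0.
have el : e <= l by apply: leq_trans l0; apply: leq_addr.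
have [|E [Ef EX]] := folkman_pattern_num m_gt1 cE eE CE (erefl (4 ^ l)) (erefl _) (erefl _) el.
  by apply: (poly_le_exp2 b5); apply: leq_trans l0; apply: leq_addl.
exists (c * (C * 4 ^ l * l ^ 2)), E; split=> //.
by rewrite expnMn -mulnn !mulnA; clear; lia.
Qed.

(** * From colour patterns to minimal Ramsey graphs *)

From mathcomp Require Import boolp.

Section RelGraph.
Variables (T : finType) (e : rel T).
Hypothesis eirr : irreflexive e.

Definition rel_edges : {set {set T}} :=
  [set s : {set T} | [exists x, exists y, (s == [set x; y]) && e x y]].

Lemma rel_edgesP s : reflect (exists x y, s = [set x; y] /\ e x y) (s \in rel_edges).
Proof.
rewrite inE; apply: (iffP existsP) => [[x /existsP[y /andP[/eqP-> h]]]|[x [y [-> h]]]].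
  by exists x, y.
by exists x; apply/existsP; exists y; rewrite eqxx.
Qed.

Lemma rel_edges_wf :
  rel_edges \subset [set s : {set T} | (s \subset [set: T]) && (#|s| == 2)].
Proof.
apply/subsetP => s /rel_edgesP[x [y [-> h]]]; rewrite inE subsetT cards2.
by case: (eqVneq x y) h => [->|//]; rewrite eirr.
Qed.

Definition rel_graph : graph T := Graph rel_edges_wf.

End RelGraph.

Lemma set2_inj (T : finType) (x y x' y' : T) :
  [set x; y] = [set x'; y'] -> (x = x' /\ y = y') \/ (x = y' /\ y = x').
Proof.
move=> h.
have /set2P[hx|hx] : x \in [set x'; y'] by rewrite -h set21.
  left; split=> //; have : y \in [set x'; y'] by rewrite -h set22.
  case/set2P => hy //.
  have : y' \in [set x; y] by rewrite h set22.
  by rewrite hx hy setUid inE => /eqP.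
right; split=> //; have : y \in [set x'; y'] by rewrite -h set22.
case/set2P => hy //.
have : x' \in [set x; y] by rewrite h set21.
by rewrite hx hy setUid inE => /eqP.
Qed.

Lemma rel_edges_set2 (T : finType) (e : rel T) x y :
  symmetric e -> ([set x; y] \in rel_edges e) = e x y.
Proof.
move=> esym; apply/rel_edgesP/idP => [[x' [y' [/set2_inj[] [-> ->]]]] //|h].
  by rewrite esym.
by exists x, y.
Qed.

Lemma clique_copy (T : finType) (e : rel T) (eirr : irreflexive e) (k r : nat)
    (c : {set T} -> 'I_r) (i : 'I_r) (g : 'I_k -> T) :
  (forall a b, a != b -> e (g a) (g b) /\ c [set g a; g b] = i) ->
  exists (f : 'I_k -> T) (i : 'I_r), is_copy (complete_graph k) (rel_graph eirr) f /\
    {in edges (complete_graph k), forall s : {set 'I_k}, c (f @: s) = i}.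
Proof.
move=> h; exists g, i.
have imE s : s \in edges (complete_graph k) -> exists a b, a != b /\ g @: s = [set g a; g b].
  rewrite inE => /cards2P[a [b [ab ->]]]; exists a, b; split=> //.
  by rewrite imsetU !imset_set1.
split; first split.
- move=> a b _ _ gab; apply/eqP; apply: contraT => /h[].
  by rewrite gab eirr.
- by move=> u _; rewrite inE.
- move=> s /imE[a [b [/h[hab _] ->]]]; apply/rel_edgesP; by exists (g a), (g b).
by move=> s /imE[a [b [/h[_ hab] ->]]].
Qed.

Lemma ramsey_minimal_subgraph (U T : finType) (r : nat) (H : graph U) (G : graph T) :
  ramsey r H G -> exists2 G' : graph T, subgraph G' G & ramsey_minimal r H G'.
Proof.
have [n] := ubnP (#|vertices G| + #|edges G|).
elim: n G => // n IH G hn hG.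
have [hmin|] := EM (forall G', proper_subgraph G' G -> ~ ramsey r H G').
  by exists G.
move=> /existsNP[G' /not_implyP[[[sV sE] neq] /contrapT rG']].
have lt : #|vertices G'| + #|edges G'| < #|vertices G| + #|edges G|.
  have lV := subset_leqif_cards sV; have lE := subset_leqif_cards sE.
  have := leqif_add lV lE; move=> hle; rewrite (ltn_leqif hle).
  by apply/negP => /andP[/eqP eV /eqP eE]; apply/neq/graph_eq.
have [G'' [sV' sE'] mG''] := IH G' (leq_trans lt hn) rG'.
by exists G'' => //; split; [exact: subset_trans sV' sV|exact: subset_trans sE' sE].
Qed.

Lemma min_degree_le (T : finType) (G : graph T) v :
  v \in vertices G -> min_degree G <= degree G v.
Proof.
move=> vG; rewrite /min_degree -big_filter.
have : v \in [seq x <- index_enum T | x \in vertices G].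
  by rewrite mem_filter vG mem_index_enum.
elim: (filter _ _) => // x s IH; rewrite inE big_cons => /predU1P[->|/IH h].
  exact: geq_minl.
exact: leq_trans (geq_minr _ _) h.
Qed.

Lemma is_s_exists (U T : finType) (r n : nat) (H : graph U) (G : graph T) :
  ramsey_minimal r H G -> min_degree G <= n -> exists s, is_s r H s /\ s <= n.
Proof.
move=> hG hn.
pose A d := exists (T : finType) (G : graph T), ramsey_minimal r H G /\ min_degree G = d.
have exA : exists d, `[< A d >] by exists (min_degree G); apply/asboolP; exists T, G.
exists (ex_minn exA); case: ex_minnP => s /asboolP As min; split.
  by split=> // d Ad; apply: min; apply/asboolP.
by apply: leq_trans (min _ _) hn; apply/asboolP; exists T, G.
Qed.

Section Reduction.
Variables (r k n : nat).
Hypotheses (r_gt0 : 0 < r) (k_gt1 : 1 < k).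
Variable E : 'I_r -> rel 'I_n.
Hypothesis Efree : kfree_coloring k.+1 E.
Hypothesis Efolkman : forall f : 'I_n -> 'I_r, exists (i : 'I_r) (g : 'I_k -> 'I_n),
  clique_map (E i) g /\ forall a, f (g a) = i.

(* The gadgets: for distinct colours [j] and [j'], a clique with one edge of
   colour [j] and the others of colour [j']. *)
Let TA : finType := ('I_n + 'I_r * 'I_r * 'I_k.+1)%type.

Definition gadget_edges (i : 'I_r) : rel TA := fun u v =>
  match u, v with
  | inl x, inl y => E i x y
  | inr (jj, a), inr (jj', b) =>
      [&& jj == jj', jj.1 != jj.2, a != b &
        i == if (a < 2) && (b < 2) then jj.1 else jj.2]
  | _, _ => false
  end.

(** A clique of [k.+1] vertices in a gadget fills it, so it contains the edges 01 and 02, which have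
    different colours. *)
Lemma gadget_edges_free : kfree_coloring k.+1 gadget_edges.
Proof.
have [Esym Eirr Edisj Efr] := Efree; split.
- move=> i [x|[jj a]] [y|[jj' b]] //=; first exact: Esym.
  rewrite [b == a]eq_sym [jj' == _]eq_sym [(b < 2) && _]andbC.
  by case: (eqVneq jj jj') => [->|].
- by move=> i [x|[jj a]] /=; rewrite ?Eirr ?eqxx ?andbF.
- move=> i i' [x|[jj a]] [y|[jj' b]] //=; first exact: Edisj.
  by move=> /and4P[_ _ _ /eqP->] /and4P[_ _ _ /eqP->].
move=> i g cl.
case g0: (g ord0) => [x0|[jj a0]].
  have H a : exists x, g a = inl x.
    have [->|na] := eqVneq a ord0; first by exists x0.
    move: (cl a ord0 na); rewrite g0; case: (g a) => [x _|[]//]; by exists x.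
  have [f fP] : exists f : 'I_k.+1 -> 'I_n, forall b, g b = inl (f b).
    have H' b : exists x, g b == inl x by case: (H b) => x ->; exists x.
    by exists (fun b => xchoose (H' b)) => b; exact/eqP/(xchooseP (H' b)).
  by apply: (Efr i f) => a b /cl; rewrite !fP.
have H a : exists b, g a = inr (jj, b).
  have [->|na] := eqVneq a ord0; first by exists a0.
  move: (cl a ord0 na); rewrite g0; case: (g a) => [x //|[jj' b]] /and4P[/eqP-> _ _ _].
  by exists b.
have [f fP] : exists f : 'I_k.+1 -> 'I_k.+1, forall b, g b = inr (jj, f b).
  have H' b : exists x, g b == inr (jj, x) by case: (H b) => x ->; exists x.
  by exists (fun b => xchoose (H' b)) => b; exact/eqP/(xchooseP (H' b)).
have finj : injective f.
  move=> a b fab; apply/eqP; apply: contraT => /cl; by rewrite !fP fab /= !eqxx andbF.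
pose v (u : nat) : 'I_k.+1 := invF finj (inord u).
have fv u : f (v u) = inord u by rewrite f_invF.
have vE u u' : u <= 2 -> u' <= 2 -> u != u' -> gadget_edges i (inr (jj, inord u)) (inr (jj, inord u')).
  move=> hu hu' nuu; rewrite -!fv -!fP; apply: cl; apply: contraNneq nuu.
  by move/(congr1 f); rewrite !fv => /(congr1 val); rewrite /= !inordK ?ltnS ?(leq_trans hu) ?(leq_trans hu') // => ->.
have k_gt0 := ltnW k_gt1.
have /and4P[_ + _ /eqP e1] := vE 0 1 isT isT isT.
have /and4P[_ _ _ /eqP e2] := vE 0 2 isT isT isT.
by move: e1 e2; rewrite !inordK //= ?ltnS // => -> ->; rewrite eqxx.
Qed.

Lemma s_complete_le : exists s, is_s r (complete_graph k.+1) s /\ s <= n.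
Proof.
pose c0 : 'I_r := Ordinal r_gt0.
have [T' [E' [Ef' H']]] := edge_ramsey_coloring c0 (k_gt1 : 2 < k.+1) gadget_edges_free.
have [Esym Eirr Edisj Efr] := Ef'.
(* Every map from the pattern vertices gets a new vertex, joined to the at most [n] vertices of its
   image. *)
pose TG : finType := (T' + {ffun 'I_n -> T'})%type.
pose adj : rel TG := fun u v =>
  match u, v with
  | inl x, inl y => [exists i, E' i x y]
  | inl x, inr f => x \in codom f
  | inr f, inl x => x \in codom f
  | _, _ => false
  end.
have adjsym : symmetric adj.
  by move=> [x|f] [y|f'] //=; apply: eq_existsb => i; rewrite Esym.
have adjirr : irreflexive adj.
  by move=> [x|f] //=; apply/existsP => -[i]; rewrite Eirr.
pose G := rel_graph adjirr.
have Gram : ramsey r (complete_graph k.+1) G.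
  move=> c.
  have [x y|h [hom [d Hd]]] := H' (fun x y => c [set inl x; inl y]).
    by rewrite setUC.
  (* If [d] identifies [j] and [j'], the gadget of this pair is a monochromatic clique. *)
  have [dinj|] := boolP (injectiveb d); last first.
    case/injectivePn => j [j' jj' djj'].
    pose g (a : 'I_k.+1) : TG := inl (h (inr ((j, j'), a))).
    apply: (@clique_copy _ _ adjirr _ _ _ (d j) g) => a b ab.
    pose i := if (a < 2) && (b < 2) then j else j'.
    have e : gadget_edges i (inr ((j, j'), a)) (inr ((j, j'), b)).
      by rewrite /= eqxx jj' ab eqxx.
    split; first by apply/existsP; exists i; apply: hom.
    by rewrite (Hd _ _ _ e) /i; case: ifP.
  move/injectiveP in dinj.
  pose v : TG := inr [ffun u => h (inl u)].
  (* A pattern vertex receives the pattern colour that [d] turns into the colour of its edge to [v];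
     the resulting clique extends by [v]. *)
  have [i [g [cl gi]]] := Efolkman (fun u => invF dinj (c [set v; inl (h (inl u))])).
  pose g' (a : 'I_k.+1) : TG := if unlift ord0 a is Some b then inl (h (inl (g b))) else v.
  have vadj b : adj v (inl (h (inl (g b)))).
    by apply/codomP; exists (g b); rewrite ffunE.
  have vcol b : c [set v; inl (h (inl (g b)))] = d i.
    by rewrite -(gi b) f_invF.
  apply: (@clique_copy _ _ adjirr _ _ _ (d i) g') => a b; rewrite /g'.
  case: unliftP => [a'|] ->; case: unliftP => [b'|] -> // nab.
  - have e : gadget_edges i (inl (g a')) (inl (g b')).
      by apply: cl; apply: contraNneq nab => ->.
    by split; [apply/existsP; exists i; apply: hom|apply: Hd e].
  - by split; [exact: vadj|rewrite setUC; exact: vcol].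
have [G' [sV sE] [rG' mG']] := ramsey_minimal_subgraph Gram.
(* Without new vertices, each edge could take its colour in [E'], where no clique is monochromatic;
   other sets take the default [c0]. *)
have [f fG'] : exists f, inr f \in vertices G'.
  apply: contrapT => /forallNP none.
  pose P (s : {set TG}) i := [exists x, exists y, (s == [set inl x; inl y]) && E' i x y].
  pose c (s : {set TG}) := if [pick i | P s i] is Some i then i else c0.
  have cE i x y : E' i x y -> c [set inl x; inl y] = i.
    move=> e; rewrite /c.
    have Pi : P [set inl x; inl y] i.
      by apply/existsP; exists x; apply/existsP; exists y; rewrite eqxx.
    case: pickP => [i'|/(_ i)]; last by rewrite Pi.
    move=> /existsP[x' /existsP[y' /andP[/eqP s' e']]].
    by case: (set2_inj s') => -[[xx] [yy]]; subst x' y'; apply: Edisj e' _; rewrite // Esym.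
  have [g [i [[_ gV gE] gc]]] := rG' c.
  have H a : exists x, g a = inl x.
    have := gV a (in_setT a); case: (g a) => [x _|f]; first by exists x.
    by move/none.
  have [w wP] : exists w : 'I_k.+1 -> T', forall b, g b = inl (w b).
    have H'' b : exists x, g b == inl x by case: (H b) => x ->; exists x.
    by exists (fun b => xchoose (H'' b)) => b; exact/eqP/(xchooseP (H'' b)).
  apply: (Efr i w) => a b ab.
  have eab : [set a; b] \in edges (complete_graph k.+1) by rewrite inE cards2 ab.
  have gab : g @: [set a; b] = [set inl (w a); inl (w b)].
    by rewrite imsetU !imset_set1 !wP.
  have := gc _ eab; rewrite gab.
  have := subsetP sE _ (gE _ eab); rewrite gab rel_edges_set2 // => /existsP[i' e].
  by rewrite (cE _ _ _ e) => <-.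
apply: (is_s_exists (G := G')) => //.
apply: leq_trans (min_degree_le fG') _.
rewrite /degree -[X in _ <= X]card_ord -cardsT.
apply: leq_trans (leq_imset_card (fun u : 'I_n => [set inr f; inl (f u)] : {set TG}) _).
apply: subset_leq_card; apply/subsetP => s; rewrite inE => /andP[/(subsetP sE)].
case/rel_edgesP => -[x|f1] [[y|f2] [-> //= h]]; rewrite !inE //= ?orbF.
  case/eqP => ff; subst f2; case/codomP: h => u ->; apply/imsetP; exists u => //.
  by rewrite setUC.
by case/eqP => ff; subst f1; case/codomP: h => u ->; apply/imsetP; exists u.
Qed.
End Reduction.

(* The bound in terms of real logarithms *)
From mathcomp Require Import all_order all_algebra ring.
From mathcomp Require Import all_reals all_analysis.
Import Order.TTheory GRing.Theory Num.Theory.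
Local Open Scope ring_scope.

(** Only the first [r] of the [4 ^ l] colours are kept. Among [r] classes of the [4 ^ l * t]
    vertices one has at least [t] elements, where the pattern provides a clique of its colour. *)
Lemma s_complete_bound (m : nat) : (1 < m)%N -> exists A l0 : nat, forall r l,
  (0 < r)%N -> (l0 <= l)%N -> (r <= 4 ^ l)%N ->
  exists s, is_s r (complete_graph m.+1) s /\ (s <= A * (4 ^ l * l) ^ 2)%N.
Proof.
move=> m1; have [A [l0 H]] := folkman_pattern m1.
exists A, l0 => r l r0 ll rl; have [t [E [<- [Esym Eirr Edisj Efr] EX]]] := H l ll.
pose E' (i : 'I_r) := E (widen_ord rl i).
apply: (@s_complete_le r m _ r0 m1 E').
  split=> [i|i|i i' x y e e'|i]; rewrite /E' //.
  by apply/val_inj/(congr1 val (Edisj _ _ _ _ e e')).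
move=> f; have [|i hi] := @pigeonhole_class _ _ (Ordinal r0) f [set: _] t.
  by rewrite cardsT !card_ord leq_mul2r rl orbT.
have [X Xi Xt] := subset_card_exists hi.
have [g [gcl gX]] := EX X Xt (widen_ord rl i).
exists i, g; split=> // a; have := subsetP Xi _ (gX a).
by rewrite !inE => /eqP.
Qed.

(** The choice is [l0] plus the rounded-up logarithm of [r] to base 4: the shift makes [l] large
    enough for every [r], at the price of constants. *)
Lemma up_log4_bound (R : realType) (l0 r : nat) : (2 <= r)%N ->
  exists l, [/\ (l0 <= l)%N, (r <= 4 ^ l)%N, (4 ^ l <= 4 ^ l0.+1 * r)%N &
    l%:R * ln 2 <= l0.+2%:R * ln (r%:R : R)].
Proof.
move=> r2; pose u := up_log 4 r.
have u0 : (0 < u)%N by rewrite up_log_gt0.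
have ur : (r <= 4 ^ u)%N by apply: up_logP.
have ru : (4 ^ u.-1 < r)%N.
  by have /andP[] := up_log_bounds (isT : (1 < 4)%N) r2.
exists (l0 + u)%N; split.
- exact: leq_addr.
- by apply: leq_trans ur _; rewrite leq_exp2l // leq_addl.
- by rewrite -(prednK u0) addnS -addSn expnD leq_mul2l ltnW ?orbT.
have ln2r : ln 2 <= ln (r%:R : R) by rewrite ler_ln ?posrE ?ltr0n ?ler_nat // ltnW.
have lnu : u.-1%:R * ln 2 <= ln (r%:R : R).
  rewrite mulr_natl -lnXn // ler_ln ?posrE ?exprn_gt0 // ?ltr0n ?(ltnW r2) //.
  rewrite -natrX ler_nat; apply: leq_trans (ltnW ru).
  by case: (u.-1) => // v; rewrite leq_exp2r.
have -> : (l0 + u = l0.+1 + u.-1)%N by rewrite addSn -addnS prednK.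
rewrite natrD mulrDl -[l0.+2]addn1 [(l0.+1 + 1)%:R]natrD mulrDl mul1r lerD //.
by rewrite ler_wpM2l.
Qed.

Theorem theorem2 (R : realType) (k : nat) (hk : (3 <= k)%N) :
  exists C : R, forall r : nat, (2 <= r)%N ->
    exists s : nat, is_s r (complete_graph k) s /\
      s%:R <= C * (r%:R * ln (r%:R : R)) ^+ 2.
Proof.
case: k hk => // m m1; have [A [l0 H]] := s_complete_bound m1.
have ln2 : 0 < ln 2 :> R by rewrite ln_gt0 // ltr1n.
(* The factors squared are the losses in replacing [4 ^ l] by [r] and [l] by [ln r]. *)
exists (A%:R * ((4 ^ l0.+1)%:R * l0.+2%:R / ln 2) ^+ 2) => r r2.
have [l [ll rl l4 lln]] := up_log4_bound R l0 r2.
have [s [hs sA]] := H r l (ltnW r2) ll rl; exists s; split=> //.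
have : s%:R <= (A * (4 ^ l * l) ^ 2)%:R :> R by rewrite ler_nat.
move=> /le_trans; apply; rewrite natrM natrX -(mulrA A%:R) -exprMn ler_wpM2l //.
apply: lerXn2r; rewrite ?nnegrE //.
  by rewrite !mulr_ge0 ?invr_ge0 ?(ltW ln2) ?ln_ge0 ?ler1n ?(ltnW r2).
have -> : (4 ^ l0.+1)%:R * l0.+2%:R / ln 2 * (r%:R * ln r%:R) =
   (4 ^ l0.+1 * r)%:R * (l0.+2%:R * ln r%:R / ln 2) :> R.
  by rewrite natrM; ring.
by rewrite natrM ler_pM // ?ler_nat // ler_pdivlMr.
Qed.
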